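(* Given a self-delimiting Turing machine $C$ we can effectively construct a tuatara machine $V$ such that $\zeta_V=\Omega_C$. Furthermore, $\mathrm{dom}(V)\supseteq\mathrm{dom}(C)$, and to each string $p\in\mathrm{dom}(C)$ there correspond $HW(p)+1$ strings in $\mathrm{dom}(V)$, $p$ among them.
   Context: Turing machines map binary strings to binary strings (partial functions on $\Sigma^*$, $\Sigma=\{0,1\}$); $\mathrm{dom}(M)$ is the set of inputs on which $M$ halts; $M$ is self-delimiting if $\mathrm{dom}(M)$ is prefix-free. $\mathrm{bin}:\mathbf{N}=\{1,2,\dots\}\to\Sigma^*$ is the bijection sending $n$ to its binary expansion with the leading 1 removed. $\Omega_M=\sum_{p\in\mathrm{dom}(M)}2^{-|p|}$, $\zeta_M=\sum_{n\ge1,\ \mathrm{bin}(n)\in\mathrm{dom}(M)}\frac1n$. $M$ is a tuatara machine if $\zeta_M\le1$. $HW(p)$ is the Hamming weight of $p$, the number of 1 bits in $p$. *)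

(* Defs.v *)
From HB Require Import structures.
From mathcomp Require Import all_boot all_order all_algebra.
From mathcomp Require Import all_classical all_reals all_analysis.

Set Implicit Arguments.
Unset Strict Implicit.
Unset Printing Implicit Defensive.

Import Order.TTheory GRing.Theory Num.Theory.

Local Open Scope classical_set_scope.

Definition word := seq bool.

(** Deterministic Turing machines with one two-way infinite tape, presented as
    a finite table of quintuples.  States and symbols are natural numbers (only
    finitely many occur in a table); the initial state is [0].  The tape
    alphabet is not restricted to {blank, 0, 1}. *)

Inductive direction := Left | Stay | Right.

Record quintuple := Quintuple {
  cur_state : nat;
  cur_symbol : nat;
  new_state : nat;
  new_symbol : nat;
  head_move : direction }.

(** If several quintuples have the same state and symbol, the first one in the
    list is the one which applies, so that every list is a machine. *)
Definition TM := seq quintuple.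

Definition blank : nat := 0.
Definition symbol_of_bit (b : bool) : nat := if b then 2 else 1.
Definition bit_of_symbol (a : nat) : option bool :=
  match a with 1 => Some false | 2 => Some true | _ => None end.

(** [left_part] lists the cells to the left of the head, nearest first, and
    [right_part] those to its right; all the cells beyond are blank. *)
Record config := Config {
  state : nat;
  left_part : seq nat;
  scanned : nat;
  right_part : seq nat }.

Definition write_move (q a : nat) (d : direction) (c : config) : config :=
  let: Config _ l _ r := c in
  match d with
  | Left => Config q (behead l) (head blank l) (a :: r)
  | Stay => Config q l a r
  | Right => Config q (a :: l) (head blank r) (behead r)
  end.

Definition applicable (c : config) (i : quintuple) : bool :=
  (cur_state i == state c) && (cur_symbol i == scanned c).

(** [None] means that no quintuple applies, i.e. that the machine halts. *)
Definition step (M : TM) (c : config) : option config :=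
  if [seq i <- M | applicable c i] is i :: _
  then Some (write_move (new_state i) (new_symbol i) (head_move i) c)
  else None.

(** The head starts on the first symbol of the input. *)
Definition initial (x : word) : config :=
  let s := map symbol_of_bit x in Config 0 [::] (head blank s) (behead s).

Fixpoint leading_bits (s : seq nat) : word :=
  if s is a :: s' then
    if bit_of_symbol a is Some b then b :: leading_bits s' else [::]
  else [::].

(** The output is the longest block of bits starting at the scanned cell, so
    every halting computation has an output. *)
Definition output (c : config) : word :=
  leading_bits (scanned c :: right_part c).

Definition computes (M : TM) (x y : word) : Prop :=
  exists (t : nat) (c : config),
    [/\ iter t (obind (step M)) (Some (initial x)) = Some c,
        step M c = None & output c = y].

Definition dom (M : TM) : set word := [set x | exists y, computes M x y].

(** Descriptions of machines as binary strings: the five entries of each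
    quintuple are written in the prefix-free unary code [n |-> 1^n 0]. *)
Definition unary (n : nat) : word := rcons (nseq n true) false.

Definition nat_of_direction (d : direction) : nat :=
  match d with Left => 0 | Stay => 1 | Right => 2 end.

Definition encode_quintuple (i : quintuple) : word :=
  flatten [seq unary n | n <- [:: cur_state i; cur_symbol i; new_state i;
                                  new_symbol i; nat_of_direction (head_move i)]].

Definition encode (M : TM) : word := flatten (map encode_quintuple M).

Lemma unary_cat_inj m n s t : unary m ++ s = unary n ++ t -> m = n /\ s = t.
Proof.
rewrite /unary; elim: m n => [|m IHm] [|n] //= [] //.
by move=> /IHm[-> ->].
Qed.

Lemma encode_inj : injective encode.
Proof.
elim=> [|[q a q' a' d] M IHM] [|[p b p' b' e] N] //; rewrite /encode /=.
- by case: p.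
- by case: q.
rewrite /encode_quintuple /= !cats0 -!catA.
move=> /unary_cat_inj[-> /unary_cat_inj[-> /unary_cat_inj[->]]].
move=> /unary_cat_inj[-> /unary_cat_inj[de /IHM->]].
by case: d e de => [] [].
Qed.

Definition self_delimiting (M : TM) : Prop :=
  forall p q : word, dom M p -> dom M q -> prefix p q -> p = q.

(** For [n >= 1], the binary digits of [n] of weights [2 ^ i] with
    [i < trunc_log 2 n], the most significant first: this omits exactly the
    leading [1].  The value at [n = 0] is irrelevant. *)
Definition bin (n : nat) : word :=
  [seq odd (n %/ 2 ^ i) | i <- rev (iota 0 (trunc_log 2 n))].

(** Both sums have nonnegative terms and are taken in the extended reals. *)
Definition Omega (R : realType) (M : TM) : \bar R :=
  esum (dom M) (fun p : word => (2 ^- size p)%R%:E).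

Definition zeta (R : realType) (M : TM) : \bar R :=
  esum [set n : nat | (1 <= n)%N /\ dom M (bin n)]
    (fun n : nat => (n%:R^-1)%R%:E).

Definition tuatara (R : realType) (M : TM) : Prop := (zeta R M <= 1)%E.

Definition HW (p : word) : nat := count_mem true p.

(* Main.v *)
Require Import Defs.
From HB Require Import structures.
From mathcomp Require Import all_boot all_order all_algebra.
From mathcomp Require Import all_classical all_reals all_analysis.
From mathcomp Require Import ring lra.

Set Implicit Arguments.
Unset Strict Implicit.
Unset Printing Implicit Defensive.

Local Open Scope classical_set_scope.
Local Open Scope card_scope.

(** If [n] is the number with binary digits [1p] and [k] is the length of [p],
    then [2^-k = (1/n) * (n / 2^k)], and [n / 2^k] is the sum of [2^-j] over the
    positions [j] of the ones of [1p], counted from 0.  So [2^-k] is the sum of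
    the [HW p + 1] numbers [1 / (n * 2^j)], and [n * 2^j] is the number of the
    word [p 0^j].  Let [dom V] consist of these words for [p] in [dom C]: they
    are distinct because [dom C] is prefix-free, and [zeta V = Omega C <= 1] by
    Kraft's inequality.

    To build [V], stack programs are compiled to Turing machines, each stack
    being a track of the tape.  [V] is a fixed universal program preceded by
    instructions which write the description of [C] in front of the input
    [w]; for [t = 1, 2, ...] it runs [C] for [t] steps on every [p] such that
    [w = p 0^j] for an admissible [j].  Only the description of [C] varies,
    so a stack program can also produce [encode V] from [encode C]. *)

(** * Compiling stack programs to Turing machines *)

(** Effectivity is stated through a Turing machine [T], fixed before [C], which has to print
    [encode V]. So the compiler serves twice, for [V] and for [T]. This also dictates the layout of
    a compiled machine: program states and cell codes are numbered independently of the prepended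
    letters, whose rows use the states from [nstates] upward, so that [C] influences only a regular
    block of rows and the row after it. A candidate [p] may make [C] run forever, so membership in
    [dom V] is only semi-decided, by rounds of growing length, and divergence of [V] elsewhere has
    to be proved as well. It passes from programs to machines because each stack command costs at
    least one machine step. Since [encode] writes numbers in a terminated unary code, a stack of
    letters can be read as a list of naturals. Then [encode C] serves as the table of [C] without
    any decoding, and configurations of [C], whose states and symbols are unbounded over all [C],
    are stored as such lists too. *)

Definition run (M : TM) (n : nat) (c : config) : option config :=
  iter n (obind (step M)) (Some c).

Lemma iter_obind_None (A : Type) (f : A -> option A) n :
  iter n (obind f) None = None.
Proof. by elim: n => //= n ->. Qed.

Lemma iter_obind_add (A : Type) (f : A -> option A) m n x y z :
  iter m (obind f) (Some x) = Some y -> iter n (obind f) (Some y) = Some z ->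
  iter (n + m) (obind f) (Some x) = Some z.
Proof. by move=> xy yz; rewrite iterD xy. Qed.

Lemma halt_bound M c t c' m d :
  run M t c = Some c' -> step M c' = None -> run M m c = Some d -> m <= t.
Proof.
rewrite /run => ct ht cm; rewrite leqNgt; apply/negP => /subnK tm.
by move: cm; rewrite -tm addnS -addSn iterD ct iterSr /= ht iter_obind_None.
Qed.

HB.instance Definition _ := gen_eqMixin quintuple.

(** [step] fires the first matching row; when the match is unique, the order of the rows is
    irrelevant. *)
Lemma step_row M c i :
  i \in M -> applicable c i -> (forall j, j \in M -> applicable c j -> j = i) ->
  step M c = Some (write_move (new_state i) (new_symbol i) (head_move i) c).
Proof.
move=> iM ci uniq_i; rewrite /step.
have: i \in [seq j <- M | applicable c j] by rewrite mem_filter ci.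
have: forall j, j \in [seq j <- M | applicable c j] -> j = i.
  by move=> j; rewrite mem_filter => /andP[/uniq_i + /[dup] jM]; apply.
by case: [seq _ <- _ | _] => // j s /(_ j (mem_head _ _)) ->.
Qed.

Lemma step_none M c : (forall j, j \in M -> ~~ applicable c j) -> step M c = None.
Proof.
move=> Mc; rewrite /step; case E: [seq _ <- _ | _] => [|j s] //.
have: j \in j :: s by rewrite mem_head.
by rewrite -E mem_filter => /andP[cj /Mc]; rewrite cj.
Qed.

(** The default [0] is the blank, which is no bit: it stops [leading_bits] after [w], whether [s]
    ends there or goes on with blanks. *)
Lemma leading_bitsE s w :
  (forall n, nth 0 s n = nth 0 (map symbol_of_bit w) n) -> leading_bits s = w.
Proof.
elim: w s => [|b w IHw] [|a s] //= sw.
- by move: (sw 0) => /= ->.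
- by move: (sw 0); case: (b).
- move: (sw 0) => /= ->; rewrite (IHw s) => [|n]; last exact: (sw n.+1).
  by case: b {sw}.
Qed.

(** [None] is a separator: on the input stack of [V] it stands between the input and the description
    of [C]. *)
Definition letter := option bool.

Definition store := nat -> seq letter.

Definition upd (A : Type) (f : nat -> A) (i : nat) (a : A) (j : nat) : A :=
  if j == i then a else f j.

Inductive phase := Home | Seek | Look | Back.

HB.instance Definition _ := gen_eqMixin phase.

(** * Stack commands, their finite control, and the compiled table *)

Section StackMachine.
Variable K' : nat.
Let K := K'.+1.

Inductive cmd :=
| Skip
| Push of 'I_K & letter
| Pop of 'I_K
| Seq of cmd & cmd
| If of 'I_K & (option letter -> bool) & cmd & cmd
| While of 'I_K & (option letter -> bool) & cmd.

(** The tests inside commands are functions, so equality is taken classically; it serves to number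
    control states by their index in a list. *)
HB.instance Definition _ := gen_eqMixin cmd.

Definition succ (c : cmd) (k : seq cmd) (o : option letter) : seq cmd :=
  match c with
  | Skip | Push _ _ | Pop _ => k
  | Seq c1 c2 => c1 :: c2 :: k
  | If _ t c1 c2 => (if t o then c1 else c2) :: k
  | While _ t d => if t o then d :: c :: k else k
  end.

Definition reg (c : cmd) : option 'I_K :=
  match c with
  | Skip | Seq _ _ => None
  | Push i _ | Pop i | If i _ _ _ | While i _ _ => Some i
  end.

Definition effect (c : cmd) (s : store) : store :=
  match c with
  | Push i a => upd s i (a :: s i)
  | Pop i => upd s i (behead (s i))
  | _ => s
  end.

Definition top (s : store) (o : option 'I_K) : option letter :=
  if o is Some i then ohead (s i) else None.

Definition cstep (x : seq cmd * store) : option (seq cmd * store) :=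
  if x.1 is c :: k then Some (succ c k (top x.2 (reg c)), effect c x.2)
  else None.

(** A control state is the list of commands still to be executed. The body of a loop always has the
    continuation [c :: k], so finitely many lists occur. *)
Fixpoint conts (c : cmd) (k : seq cmd) : seq (seq cmd) :=
  (c :: k) :: match c with
  | Seq c1 c2 => conts c1 (c2 :: k) ++ conts c2 k
  | If _ _ c1 c2 => conts c1 k ++ conts c2 k
  | While _ _ d => conts d (c :: k)
  | _ => [::]
  end.

Lemma conts_head c k : c :: k \in conts c k.
Proof. by case: c => *; exact: mem_head. Qed.

(** Closure under execution makes the control finite, so that continuations can be states of a
    Turing machine. The list [k] is added because execution may leave [c]. *)
Lemma conts_succ c k d l o :
  d :: l \in conts c k -> succ d l o \in k :: conts c k.
Proof.
elim: c k => [|i a|i|c1 IH1 c2 IH2|i t c1 IH1 c2 IH2|i t c IHc] k /=;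
  rewrite !inE.
- by move=> /eqP[-> ->]; rewrite eqxx.
- by move=> /eqP[-> ->]; rewrite eqxx.
- by move=> /eqP[-> ->]; rewrite eqxx.
- rewrite mem_cat => /predU1P[[-> ->]|/orP[/IH1|/IH2]] /=.
  + by rewrite mem_cat conts_head !orbT.
  + rewrite inE mem_cat => /predU1P[->|->]; last by rewrite !orbT.
    by rewrite conts_head !orbT.
  + by rewrite inE mem_cat => /predU1P[->|->]; rewrite ?eqxx ?orbT.
- rewrite mem_cat => /predU1P[[-> ->]|/orP[/IH1|/IH2]] /=.
  + by rewrite mem_cat; case: (t o); rewrite conts_head !orbT.
  + by rewrite inE mem_cat => /predU1P[->|->]; rewrite ?eqxx ?orbT.
  + by rewrite inE mem_cat => /predU1P[->|->]; rewrite ?eqxx ?orbT.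
- move=> /predU1P[[-> ->]|/IHc] /=.
  + by case: (t o); rewrite ?eqxx ?conts_head ?orbT.
  + by rewrite inE => /predU1P[->|->]; rewrite ?eqxx ?orbT.
Qed.

(** A tape cell: [None] is the origin mark, [Some v] holds one letter (or
    nothing) for each of the [K] tracks. *)
Definition cell := option {ffun 'I_K -> option letter}.

Definition single (o : option letter) : cell :=
  Some [ffun i => if i == ord0 then o else None].

(** The first three entries make the code agree with [blank] and
    [symbol_of_bit] on cells whose only nonempty track is track [0]. *)
Definition cells : seq cell :=
  [:: single None; single (Some (Some false)); single (Some (Some true))]
    ++ enum {: cell}.

Definition code (a : cell) : nat := index a cells.

Lemma mem_cells a : a \in cells.
Proof. by rewrite mem_cat mem_enum orbT. Qed.

Lemma code_inj : injective code.
Proof.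
by move=> a b ab; rewrite -(nth_index a (mem_cells a)) -/(code a) ab nth_index ?mem_cells.
Qed.

Lemma single_inj : injective single.
Proof. by move=> o o' [] /ffunP/(_ ord0); rewrite !ffunE. Qed.

Lemma code_single b : code (single (Some (Some b))) = symbol_of_bit b.
Proof. by rewrite /code /=; case: b; rewrite /= !(inj_eq single_inj) ?eqxx. Qed.

Lemma code_blank : code (single None) = blank.
Proof. by rewrite /code /= eqxx. Qed.

Definition put (v : {ffun 'I_K -> option letter}) i o : cell :=
  Some [ffun j => if j == i then o else v j].

(** One command is executed by leaving the origin to the right ([Seek]) up to
    the first empty cell of the relevant track, stepping back onto the top of
    the stack if it has to be read ([Look]), and returning ([Back]). *)
Definition trans (q : seq cmd * phase) (a : cell) :
    option ((seq cmd * phase) * cell * direction) :=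
  let: (x, ph) := q in
  match ph, x, a with
  | Home, [::], None => Some (([::], Seek), None, Right)
  | Home, c :: k, None =>
      if reg c then Some ((x, Seek), None, Right)
      else Some ((succ c k None, Home), None, Stay)
  | Seek, c :: k, Some v =>
      if reg c is Some i then
        if v i then Some ((x, Seek), a, Right)
        else if c is Push _ b then Some ((k, Back), put v i (Some b), Left)
        else Some ((x, Look), a, Left)
      else None
  | Look, c :: k, None => Some ((succ c k None, Home), None, Stay)
  | Look, c :: k, Some v =>
      if reg c is Some i then
        Some ((succ c k (v i), Back), (if c is Pop _ then put v i None else a), Left)
      else None
  | Back, _, None => Some ((x, Home), None, Stay)
  | Back, _, Some _ => Some ((x, Back), a, Left)
  | _, _, _ => None
  end.

Variable prog : cmd.

Definition states : seq (seq cmd * phase) :=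
  [seq (x, ph) | x <- conts prog [::] ++ [:: [::]],
                 ph <- [:: Home; Seek; Look; Back]].

(** The shift by one reserves the state [0], in which the machine starts before the origin is
    marked. *)
Definition scode (q : seq cmd * phase) : nat := (index q states).+1.

Definition nstates : nat := (size states).+1.

Definition row (x : (seq cmd * phase) * cell) : option quintuple :=
  if trans x.1 x.2 is Some (q', a', d)
  then Some (Quintuple (scode x.1) (code x.2) (scode q') (code a') d)
  else None.

Definition table : TM := pmap row [seq (q, a) | q <- states, a <- enum {: cell}].

Variable pre : seq letter.

Definition start_rows : TM :=
  [seq Quintuple 0 a nstates a Left | a <- [:: 0; 1; 2]].

Definition pre_row (i : nat) (a : letter) : quintuple :=
  Quintuple (nstates + i) blank (nstates + i.+1) (code (single (Some a))) Left.

Definition pre_rows : TM := [seq pre_row i (nth None pre i) | i <- iota 0 (size pre)].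

Definition origin_row (n : nat) : quintuple :=
  Quintuple (nstates + n) blank 1 (code None) Stay.

(** The machine first writes the letters of [pre], from right to left, and the
    origin mark in front of its input, and then executes [prog]. *)
Definition compile : TM :=
  start_rows ++ pre_rows ++ origin_row (size pre) :: table.

(** * Determinism of the compiled machine *)

Lemma mem_states x ph : (x, ph) \in states = (x \in [::] :: conts prog [::]).
Proof.
rewrite inE orbC -mem_seq1 -mem_cat.
apply/allpairsP/idP => [[[y ph'] [/= ys _ [-> _]]] //|xs].
by exists (x, ph); split=> //; case: ph; rewrite !inE eqxx ?orbT.
Qed.

Lemma mem_table i : reflect
  (exists q a q' a' d, [/\ q \in states, trans q a = Some (q', a', d) &
     i = Quintuple (scode q) (code a) (scode q') (code a') d])
  (i \in table).
Proof.
rewrite mem_pmap; apply: (iffP mapP) => [[[q a]]|[q [a [q' [a' [d [qs E ->]]]]]]].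
  move=> /allpairsP[[q0 a0] [/= qs _ [-> ->]]]; rewrite /row /=.
  case E: (trans q0 a0) => [[[q' a'] d]|] // [->].
  by exists q0, a0, q', a', d.
exists (q, a); last by rewrite /row /= E.
by apply/allpairsP; exists (q, a); split=> //; rewrite mem_enum.
Qed.

Lemma scode_inj q q' : q \in states -> q' \in states -> scode q = scode q' -> q = q'.
Proof. by move=> qs qs' [] E; rewrite -(nth_index q qs) E nth_index. Qed.

Lemma scode_lt q : q \in states -> scode q < nstates.
Proof. by rewrite /scode /nstates ltnS index_mem. Qed.

Lemma mem_compile i : i \in compile ->
  [\/ exists2 a, a < 3 & i = Quintuple 0 a nstates a Left,
      exists2 n, n < size pre & i = pre_row n (nth None pre n),
      i = origin_row (size pre) | i \in table].
Proof.
rewrite !mem_cat !inE => /or4P[/or3P[/eqP ->|/eqP ->|/eqP ->]|||].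
- by apply: Or41; exists 0.
- by apply: Or41; exists 1.
- by apply: Or41; exists 2.
- by move=> /mapP[n]; rewrite mem_iota => /= np ->; apply: Or42; exists n.
- by move=> /eqP; apply: Or43.
- exact: Or44.
Qed.

(** The groups of rows have current states in disjoint ranges: [0]; [nstates + i] with
    [i < size pre]; [nstates + size pre]; and, for the table, strictly between [0] and [nstates],
    where determinism is that of [trans]. *)
Lemma compile_uniq c i j : i \in compile -> j \in compile ->
  applicable c i -> applicable c j -> i = j.
Proof.
move=> iM jM /andP[/eqP qi /eqP ai] /andP[/eqP qj /eqP aj].
have {qi qj}: cur_state i = cur_state j by rewrite qi.
have {ai aj}: cur_symbol i = cur_symbol j by rewrite ai.
have tab_lt k : k \in table -> 0 < cur_state k < nstates.
  by move=> /mem_table[q [a [q' [a' [d [qs _ ->]]]]]]; rewrite /= scode_lt.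
move: iM => /mem_compile[[a a3 ->]|[n np ->]|->|it] /=;
move: jM => /mem_compile[[b b3 ->]|[m mp ->]|->|jt] //=.
- by move=> ->.
- by move=> _ E; move: (tab_lt _ jt); rewrite -E.
- by move=> _ /addnI->.
- by move=> _ /addnI E; rewrite E ltnn in np.
- by move=> _ E; move: (tab_lt _ jt); rewrite -E [_ + _ < _]ltnNge leq_addr andbF.
- by move=> _ /addnI E; rewrite E ltnn in mp.
- by move=> _ E; move: (tab_lt _ jt); rewrite -E [_ + _ < _]ltnNge leq_addr andbF.
- by move=> _ E; move: (tab_lt _ it); rewrite E.
- by move=> _ E; move: (tab_lt _ it); rewrite E [_ + _ < _]ltnNge leq_addr andbF.
- by move=> _ E; move: (tab_lt _ it); rewrite E [_ + _ < _]ltnNge leq_addr andbF.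
move: it jt => /mem_table[q [a [q' [a' [d [qs E ->]]]]]].
move=> /mem_table[q1 [a1 [q1' [a1' [d1 [qs1 E1 ->]]]]]] /= /code_inj ea.
by move=> /(scode_inj qs qs1) eq; move: E1; rewrite -ea -eq E => -[-> -> ->].
Qed.

Lemma compile_step c i : i \in compile -> applicable c i ->
  step compile c = Some (write_move (new_state i) (new_symbol i) (head_move i) c).
Proof.
by move=> iM ci; apply: step_row => // j jM cj; exact: compile_uniq jM iM cj ci.
Qed.

(** * Simulation of one stack command by the machine *)

Definition cellat (c : config) (n : nat) : nat :=
  nth blank (rev (left_part c) ++ scanned c :: right_part c) n.

(** Positions are counted from the left end of [left_part]. After start-up this end is the origin
    mark, which the head never passes, so positions are absolute. *)
Definition shows (c : config) (q : seq cmd * phase) (h : nat) (f : nat -> cell) :=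
  [/\ Defs.state c = scode q, size (left_part c) = h &
      forall n, cellat c n = code (f n)].

Lemma shows_scanned c q h f : shows c q h f -> scanned c = code (f h).
Proof.
by case=> _ <- <-; rewrite /cellat nth_cat size_rev ltnn subnn.
Qed.

Definition moved (h : nat) (d : direction) : nat :=
  match d with Left => h.-1 | Stay => h | Right => h.+1 end.

Lemma shows_step c q h f q' a' d : shows c q h f -> q \in states ->
  trans q (f h) = Some (q', a', d) -> (d = Left -> 0 < h) ->
  exists2 c', step compile c = Some c' &
    shows c' q' (moved h d) (fun n => if n == h then a' else f n).
Proof.
move=> cf qs E dh; have := shows_scanned cf.
case: cf => cq ch cn sc.
rewrite (@compile_step _ (Quintuple (scode q) (code (f h)) (scode q') (code a') d)).
- eexists; first by [].
  move=> /=; case: c cq ch cn sc => /= q0 l a r q0E lh cn sc.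
  have {}cn n : cellat (Config q0 l (code a') r) n =
      code (if n == h then a' else f n).
    move: (cn n); rewrite /cellat /= !nth_cat size_rev lh.
    case: ltngtP => // [nh|->]; last by rewrite subnn.
    by case: (n - h) (subn_gt0 h n) => [|m]; rewrite ?nh.
  case: d E dh => [E /(_ erefl)|E _|E _] /=.
  + case: l lh cn => [<- //|b l /= <-] cn _; split=> //= n.
    by rewrite -cn /cellat /= rev_cons cat_rcons.
  + by split.
  + split=> //=; first by rewrite lh.
    move=> n; rewrite -cn /cellat /= rev_cons cat_rcons.
    (* Moving right beyond the stored cells creates a blank, which is also the default value in
       [cellat]. *)
    case: r {cn} => //= ; rewrite !nth_cat; case: ltnP => // _.
    by case: (n - _) => //= -[|m] //=; rewrite nth_nil.
- rewrite !mem_cat inE; apply/or4P; apply: Or44; apply/mem_table.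
  by exists q, (f h), q', a', d.
- by rewrite /applicable /= cq sc !eqxx.
Qed.

(** The stacks are stored with their bottoms next to the origin. *)
Definition tape (s : store) (n : nat) : cell :=
  if n is m.+1 then Some [ffun i : 'I_K => onth (rev (s i)) m] else None.

(** The condition [0 < m] makes each command cost a machine step, so that endless programs give
    endless runs. *)
Definition goes q h f q' h' f' := forall c, shows c q h f ->
  exists2 m, 0 < m & exists2 c', run compile m c = Some c' & shows c' q' h' f'.

Lemma goes_trans q h f q1 h1 f1 q2 h2 f2 :
  goes q h f q1 h1 f1 -> goes q1 h1 f1 q2 h2 f2 -> goes q h f q2 h2 f2.
Proof.
move=> g1 g2 c /g1[m m0 [c1 cc1 /g2[n n0 [c2 cc2 sc2]]]].
exists (n + m); first by rewrite addn_gt0 m0 orbT.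
by exists c2 => //; exact: iter_obind_add cc1 cc2.
Qed.

Lemma goes_step q h f q' a' d f' : q \in states ->
  trans q (f h) = Some (q', a', d) -> (d = Left -> 0 < h) ->
  (forall n, f' n = if n == h then a' else f n) ->
  goes q h f q' (moved h d) f'.
Proof.
move=> qs E dh ff' c cf; have [c' cc' [sc' zc' fc']] := shows_step cf qs E dh.
exists 1 => //; exists c' => //; split=> // n.
by rewrite fc' ff'.
Qed.

Lemma goes_back x h f : (x, Back) \in states ->
  f 0 = None -> (forall n, f n.+1) -> goes (x, Back) h f (x, Home) 0 f.
Proof.
move=> xs f0 fS; elim: h => [|h IHh].
  by apply: (goes_step (d := Stay) xs) => [|//|[|n]] //=; rewrite f0.
case E: (f h.+1) (fS h) => [v|] // _.
apply: (goes_trans _ IHh).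
apply: (goes_step (d := Left) (a' := f h.+1) xs) => [|//|n] /=; first by rewrite E.
by case: eqP => [->|].
Qed.

Lemma goes_seek c k i (s : store) h : (c :: k, Seek) \in states -> reg c = Some i ->
  h <= size (s i) ->
  goes (c :: k, Home) 0 (tape s) (c :: k, Seek) h.+1 (tape s).
Proof.
move=> xs ci; have hs : (c :: k, Home) \in states by move: xs; rewrite !mem_states.
elim: h => [_|h IHh hh].
  by apply: (goes_step (d := Right) hs) => [|//|[|n]] //=; rewrite ci.
apply: goes_trans (IHh (ltnW hh)) _.
apply: (goes_step (d := Right) (a' := tape s h.+1) xs) => [|//|n] /=.
  rewrite ci ffunE; case E: (onth _ h) => //.
  by move: E; rewrite onthE (nth_map None) ?size_rev.
by case: eqP => [->|].
Qed.

Lemma upd_ord (s : store) (i j : 'I_K) l :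
  upd s i l j = if j == i then l else s j.
Proof. by []. Qed.

Lemma tape_push (s : store) i b n :
  tape (upd s (i : 'I_K) (b :: s i)) n =
  if n == (size (s i)).+1
  then put [ffun j : 'I_K => onth (rev (s j)) (size (s i))] i (Some b)
  else tape s n.
Proof.
case: n => [|n] //=; rewrite eqSS.
case: eqP => [->|/eqP ns]; congr Some; apply/ffunP => j; rewrite !ffunE;
  rewrite upd_ord; case: eqP => // ji; rewrite ?ji.
  by rewrite onthE map_rev /= rev_cons nth_rcons size_rev size_map ltnn eqxx.
rewrite !onthE !map_rev /= rev_cons nth_rcons size_rev size_map.
by rewrite (negPf ns); case: ltnP => // ?; rewrite nth_default // size_rev size_map.
Qed.

Lemma tape_pop (s : store) i n :
  tape (upd s (i : 'I_K) (behead (s i))) n =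
  if (0 < size (s i)) && (n == size (s i))
  then put [ffun j : 'I_K => onth (rev (s j)) (size (s i)).-1] i None
  else tape s n.
Proof.
case: n => [|n] /=; first by case: ltngtP.
case E: (s i) => [|b l] /=; rewrite ?eqSS.
  congr Some; apply/ffunP => j; rewrite !ffunE upd_ord.
  by case: eqP => // ->; rewrite E.
case: eqP => [->|/eqP ns]; congr Some; apply/ffunP => j; rewrite !ffunE;
  rewrite upd_ord; case: eqP => // ji; rewrite ?ji.
  by rewrite onthE nth_default // size_map size_rev.
rewrite E !onthE !map_rev /= rev_cons nth_rcons size_rev size_map (negPf ns).
by case: ltnP => // ?; rewrite nth_default // size_rev size_map.
Qed.

Lemma goes_cstep x s x' s' : (x, Home) \in states -> cstep (x, s) = Some (x', s') ->
  goes (x, Home) 0 (tape s) (x', Home) 0 (tape s').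
Proof.
case: x => // c k; rewrite /cstep /= => xs [<- <-].
have xS ph : (c :: k, ph) \in states by move: xs; rewrite !mem_states.
have sS ph o : (succ c k o, ph) \in states.
  by move: xs; rewrite !mem_states !inE /= => /conts_succ; apply.
case ci: (reg c) => [i|] /=; last first.
  have -> : effect c s = s by case: (c) ci.
  by apply: (goes_step (d := Stay) xs) => [|//|[|n]] //=; rewrite ci.
apply: goes_trans (goes_seek (xS _) ci (leqnn _)) _.
(* The search ends at position [(size (s i)).+1], the first cell whose track [i] is empty. *)
have top_seek : onth (rev (s i)) (size (s i)) = None.
  by rewrite onthE nth_default // size_map size_rev.
case: (boolP (if c is Push _ _ then true else false)) => [|cP].
  case: c ci xs xS sS => // j b [->] xs xS sS _ /=.
  apply: (goes_trans _ (goes_back (h := size (s i)) (sS Back None) _ _)) => //.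
  apply: (goes_step (d := Left) (xS Seek)) => [|//|n] /=; last exact: tape_push.
  by rewrite ffunE top_seek.
have : goes (c :: k, Seek) (size (s i)).+1 (tape s)
                (c :: k, Look) (size (s i)) (tape s).
  apply: (goes_step (d := Left) (a' := tape s (size (s i)).+1) (xS Seek)).
  - by rewrite /= ci ffunE top_seek; case: (c) cP.
  - by [].
  - by move=> n; case: eqP => [->|].
move=> /goes_trans; apply.
(* On an empty stack the step back meets the origin mark; the test then sees [None], and a pop
   changes nothing. *)
case E: (s i) => [|b l] /=.
  have -> : tape (effect c s) = tape s.
    apply/funext => n; case: c ci cP {xs xS sS} => //= j [->] _.
    by rewrite tape_pop E.
  by apply: (goes_step (d := Stay) (xS Look)) => // -[].
apply: (goes_trans _ (goes_back (h := size l) (sS Back (Some b)) _ _)) => //.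
apply: (goes_step (d := Left) (xS Look)) => [|//|n] /=.
  rewrite ci ffunE E.
  have -> : onth (rev (b :: l)) (size l) = Some b.
    by rewrite onthE map_rev /= rev_cons nth_rcons size_rev size_map ltnn eqxx.
  by [].
case: c ci cP {xs xS sS} => //= [j [->] _|? ? ? ? _ _|? ? ? _ _];
  try by case: eqP => [->|].
by rewrite tape_pop E.
Qed.

Lemma goes_iter n x s x' s' : (x, Home) \in states ->
  iter n (obind cstep) (Some (x, s)) = Some (x', s') ->
  (x', Home) \in states /\ forall c, shows c (x, Home) 0 (tape s) ->
  exists2 m, n <= m & exists2 c', run compile m c = Some c' &
    shows c' (x', Home) 0 (tape s').
Proof.
move=> xs; elim: n x' s' => [|n IHn] x' s' /=.
  by case=> <- <-; split=> // c cs; exists 0 => //; exists c.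
case E: (iter n _ _) => [[x1 s1]|] //= /[dup] E1 /goes_cstep g1.
have [x1s x1r] := IHn _ _ E; split.
  move: x1s E1; rewrite !mem_states; case: (x1) => // d l + [<- _].
  by rewrite inE /= => /conts_succ; apply.
move=> c /x1r[m nm [c1 cc1 /(g1 x1s)[m1 m10 [c2 cc2 sc2]]]].
exists (m1 + m); first by rewrite -[n.+1]add1n leq_add.
by exists c2 => //; exact: iter_obind_add cc1 cc2.
Qed.

(** * Start-up, halting and divergence of the compiled machine *)

Definition start_store (w : word) : store :=
  upd (fun=> [::]) 0 (rev (map Some w) ++ pre).

Lemma start_scode : scode ([:: prog], Home) = 1.
Proof. by rewrite /scode /states; case: prog => *; rewrite /= eqxx. Qed.

Lemma start_state : ([:: prog], Home) \in states.
Proof. by rewrite mem_states inE conts_head orbT. Qed.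

Lemma tape_single (l : seq letter) n :
  tape (upd (fun=> [::]) 0 l) n.+1 = single (onth (rev l) n).
Proof.
rewrite /= /single; congr Some; apply/ffunP => i; rewrite !ffunE -val_eqE /=.
by case: (nat_of_ord i) => [|j] //=; rewrite onthE nth_nil.
Qed.

Lemma run_start w : exists n, exists2 c, run compile n (initial w) = Some c &
  shows c ([:: prog], Home) 0 (tape (start_store w)).
Proof.
pose s := map symbol_of_bit w.
(* This is the right part once [n] letters of [pre] are written. The start on an empty input still
   leaves one blank cell, hence [head blank s :: behead s] instead of [s]. *)
pose r n := rev [seq code (single (Some a)) | a <- take n pre] ++
            head blank s :: behead s.
have run1 : run compile 1 (initial w) = Some (Config nstates [::] blank (r 0)).
  rewrite /run /= /r take0 /=.
  rewrite (@compile_step _ (Quintuple 0 (head blank s) nstates (head blank s) Left)) //.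
    by rewrite mem_cat /s; case: w {s r} => [|[] w]; rewrite !inE eqxx ?orbT.
  by rewrite /applicable /= !eqxx.
have runS n : n <= size pre ->
    run compile (n + 1) (initial w) = Some (Config (nstates + n) [::] blank (r n)).
  elim: n => [_|n IHn np]; first by rewrite addn0.
  rewrite addSn /run /= -/(run _ _ _) (IHn (ltnW np)) /=.
  rewrite (@compile_step _ (pre_row n (nth None pre n))).
  - by rewrite /r (take_nth None np) map_rcons rev_rcons.
  - rewrite !mem_cat; apply/orP; right; apply/orP; left.
    by apply/mapP; exists n; rewrite // mem_iota.
  - by rewrite /applicable /= !eqxx.
exists (size pre + 1).+1, (Config 1 [::] (code None) (r (size pre))).
  rewrite /run /= -/(run _ _ _) runS //=.
  rewrite (@compile_step _ (origin_row (size pre))) //.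
    by rewrite !mem_cat mem_head !orbT.
  by rewrite /applicable /= !eqxx.
split=> //=; first by rewrite start_scode.
case=> [|n] //; rewrite /start_store tape_single /cellat /= /r take_size.
rewrite rev_cat revK onthE map_cat map_rev !nth_cat !size_rev !size_map.
rewrite -!map_rev; case: ltnP => np.
  by rewrite !(nth_map None) ?size_rev.
set m := n - _; have -> : nth blank (head blank s :: behead s) m = nth blank s m.
  by case: (s) m => // -[|m] //=; rewrite nth_nil.
case: (ltnP m (size w)) => mw.
  by rewrite /s !(nth_map false) ?(nth_map None) ?size_map // (nth_map false) // code_single.
by rewrite !nth_default ?size_map // code_blank.
Qed.

(** [trans] has no transition from this state. The head is then just right of the origin, on the
    bottom of the stacks, where the output is to begin. *)
Lemma halted_step c f : shows c ([::], Seek) 1 f -> step compile c = None.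
Proof.
move=> [cq _ _]; have qs : ([::], Seek) \in states by rewrite mem_states mem_head.
apply: step_none => j /mem_compile jM; apply/negP => /andP[/eqP + _]; rewrite cq.
case: jM => [[a _ ->]|[n _ ->]|->|/mem_table[q [a [q' [a' [d [q's E ->]]]]]]] //=.
- by move=> nq; have := scode_lt qs; rewrite -nq ltnNge leq_addr.
- by move=> nq; have := scode_lt qs; rewrite -nq ltnNge leq_addr.
- by move=> /(scode_inj q's qs) qE; rewrite qE in E.
Qed.

Lemma compile_halts w n s :
  iter n (obind cstep) (Some ([:: prog], start_store w)) = Some ([::], s) ->
  exists t, exists c, [/\ run compile t (initial w) = Some c, step compile c = None &
    shows c ([::], Seek) 1 (tape s)].
Proof.
move=> /(goes_iter start_state)[_ go].
have [n0 [c0 run0 /go[n1 _ [c1 run1 sc1]]]] := run_start w.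
have qs : ([::], Home) \in states by rewrite mem_states mem_head.
have go2 : goes ([::], Home) 0 (tape s) ([::], Seek) 1 (tape s).
  by apply: (goes_step (d := Right) qs) => [|//|[|m]].
have [n2 _ [c2 run2 sc2]] := go2 _ sc1.
exists (n2 + (n1 + n0)), c2; split=> //; last exact: halted_step sc2.
by apply: iter_obind_add run2; exact: iter_obind_add run0 run1.
Qed.

(** The output is read from the bottom of stack [0] upward, whence the reversal; a cell has the code
    of a bit when all its other tracks are empty. *)
Lemma compile_computes w n (s : store) w' :
  iter n (obind cstep) (Some ([:: prog], start_store w)) = Some ([::], s) ->
  s 0 = rev (map Some w') -> (forall i, s i.+1 = [::]) ->
  computes compile w w'.
Proof.
move=> /compile_halts[t [c [run_c halt_c [_ c1 cs]]]] s0 s1.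
exists t, c; split=> //; apply: leading_bitsE => m.
have -> : nth 0 (scanned c :: right_part c) m = cellat c m.+1.
  by rewrite /cellat nth_cat size_rev c1 subSS subn0.
rewrite cs; transitivity (code (single (onth (map Some w') m))).
  rewrite -[map Some w']revK -tape_single; congr (code (Some _)).
  apply/ffunP => i; rewrite !ffunE; case: (nat_of_ord i) => [|j] /=; first by rewrite s0.
  by rewrite s1 onthE nth_nil.
rewrite onthE -map_comp; case: (ltnP m (size w')) => mw.
  by rewrite !(nth_map false) ?size_map //= code_single.
by rewrite !nth_default ?size_map // code_blank.
Qed.

Lemma compile_diverges w :
  (forall n, exists2 m, n <= m & iter m (obind cstep) (Some ([:: prog], start_store w))) ->
  ~ dom compile w.
Proof.
move=> div [y [t [c [run_c halt_c _]]]].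
have [m mt] := div t.+1; case E: (iter _ _ _) => [[x s]|] // _.
have [_ go] := goes_iter start_state E.
have [n0 [c0 run0 /go[n1 mn1 [c1 run1 _]]]] := run_start w.
have := halt_bound run_c halt_c (iter_obind_add run0 run1).
by rewrite leqNgt (leq_trans mt) // (leq_trans mn1) // leq_addr.
Qed.

End StackMachine.

(** * Stack programs *)

Arguments Skip {K'}.
Arguments cstep {K'}.

Section Exec.
Variable K' : nat.
Let K := K'.+1.
Local Notation cmd := (cmd K').
Implicit Types (c d : cmd) (i j : 'I_K) (s : store).

(** Quantifying over the continuation [k] lets commands be composed in any context. *)
Definition exec c s s' := forall k, exists n,
  iter n.+1 (obind cstep) (Some (c :: k, s)) = Some (k, s').

Lemma exec_step c s d l s1 s' :
  (forall k, cstep (c :: k, s) = Some (d :: l ++ k, s1)) ->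
  (forall k, exists n, iter n (obind cstep) (Some (d :: l ++ k, s1)) = Some (k, s')) ->
  exec c s s'.
Proof.
move=> cs ds k; have [n E] := ds k; exists n.
by rewrite iterSr /= cs.
Qed.

Lemma exec_steps c s s' k : exec c s s' -> exists n,
  iter n (obind cstep) (Some (c :: k, s)) = Some (k, s').
Proof. by move=> /(_ k)[n E]; exists n.+1. Qed.

Lemma exec_skip s : exec Skip s s.
Proof. by move=> k; exists 0. Qed.

Lemma exec_push i a s : exec (Push i a) s (upd s i (a :: s i)).
Proof. by move=> k; exists 0. Qed.

Lemma exec_pop i s : exec (Pop i) s (upd s i (behead (s i))).
Proof. by move=> k; exists 0. Qed.

Lemma exec_seq c d s s1 s2 : exec c s s1 -> exec d s1 s2 -> exec (Seq c d) s s2.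
Proof.
move=> cs ds; apply: (@exec_step (Seq c d) s c [:: d] s) => k; first by [].
have [m E] := exec_steps (d :: k) cs; have [n E'] := exec_steps (k) ds.
by exists (n + m); exact: iter_obind_add E E'.
Qed.

Lemma exec_if i t c d s s' :
  exec (if t (ohead (s i)) then c else d) s s' -> exec (If i t c d) s s'.
Proof.
move=> cs; apply: (@exec_step _ s (if t (ohead (s i)) then c else d) [::] s) => k;
  first by [].
exact: (exec_steps k cs).
Qed.

Lemma exec_while_stop i (t : option letter -> bool) c s :
  ~~ t (ohead (s i)) -> exec (While i t c) s s.
Proof. by move=> ts k; exists 0; rewrite /= /cstep /= (negPf ts). Qed.

Lemma exec_while_step i (t : option letter -> bool) c s s1 s2 : t (ohead (s i)) ->
  exec c s s1 -> exec (While i t c) s1 s2 -> exec (While i t c) s s2.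
Proof.
move=> ts cs ws; apply: (@exec_step _ s c [:: While i t c] s) => k.
  by rewrite /cstep /= ts.
have [m E] := exec_steps (While i t c :: k) cs; have [n E'] := exec_steps (k) ws.
by exists (n + m); exact: iter_obind_add E E'.
Qed.

Definition filled (o : option letter) : bool := o.

(** [Push] writes a letter fixed in the program, so reusing the top letter takes one branch for each
    of its three values. *)
Definition Switch i (f : letter -> cmd) : cmd :=
  If i (pred1 (Some None)) (f None)
    (If i (pred1 (Some (Some true))) (f (Some true)) (f (Some false))).

Lemma exec_switch i f a l s s' :
  s i = a :: l -> exec (f a) s s' -> exec (Switch i f) s s'.
Proof.
by move=> E fs; apply: exec_if; rewrite E; case: a E fs => [[]|] E fs //=;
  apply: exec_if; rewrite E.
Qed.

Definition Spill i j : cmd :=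
  While i filled (Switch i (fun a => Seq (Pop i) (Push j a))).

Lemma exec_eq c s s1 s2 : exec c s s1 -> s1 =1 s2 -> exec c s s2.
Proof. by move=> cs /funext <-. Qed.

Lemma updE (A : Type) (f : nat -> A) i a : upd f i a i = a.
Proof. by rewrite /upd eqxx. Qed.

Lemma updN (A : Type) (f : nat -> A) i j a : i != j -> upd f j a i = f i.
Proof. by rewrite /upd -val_eqE => /negPf ->. Qed.

Ltac upd_ext := move=> ?; rewrite /upd /=; repeat (case: eqP => ? /=); try congruence.

Ltac upd_at := rewrite /upd /=; repeat (case: eqP => ? //=); try congruence.

Lemma exec_spill i j s : i != j ->
  exec (Spill i j) s (upd (upd s i [::]) j (catrev (s i) (s j))).
Proof.
move=> ij; have ij' : i <> j :> nat by move/val_inj/eqP; exact/negP.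
have ji : j != i by rewrite eq_sym.
move si : (s i) => l; elim: l s si => [|a l IHl] s si.
  apply: exec_eq; first by apply: exec_while_stop; rewrite si.
  by upd_ext.
apply: exec_while_step; first by rewrite si.
  apply: (exec_switch si); exact: exec_seq (exec_pop _ _) (exec_push _ _ _).
apply: exec_eq (IHl _ _) _; first by rewrite updN // updE si.
by rewrite updE updN // si; upd_ext.
Qed.

Lemma exec_while_eq i (t : option letter -> bool) c s s' :
  ~~ t (ohead (s i)) -> s =1 s' -> exec (While i t c) s s'.
Proof. by move=> ts; apply: exec_eq; exact: exec_while_stop. Qed.

(** * Arithmetic on stacks read as lists of unary numbers *)

Definition unaries (l : seq nat) : word := flatten (map unary l).

(** The terminating [false] of a number lies below its ones: pushing [true] increments the head of
    the list, pushing [false] adds a new head [0]. *)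
Definition enc (m : nat -> seq nat) : store := fun n : nat => map Some (unaries (m n)).

Definition nexec c m m' := exec c (enc m) (enc m').

Implicit Types (m : nat -> seq nat).

Lemma unariesS n l : unaries (n.+1 :: l) = true :: unaries (n :: l).
Proof. by []. Qed.

Lemma enc_upd m i l : enc (upd m i l) = upd (enc m) i (map Some (unaries l)).
Proof. by apply/funext => j; rewrite /enc /upd; case: eqP. Qed.

Lemma enc_eq m i l : m i = l -> enc m i = map Some (unaries l).
Proof. by move=> <-. Qed.

Definition pos (o : option letter) : bool := o == Some (Some true).

Lemma pos_enc m i : pos (ohead (enc m i)) = (0 < head 0 (m i)).
Proof. by rewrite /enc; case: (m i) => [|[|n] l]. Qed.

Lemma filled_enc m i : filled (ohead (enc m i)) = (m i != [::]).
Proof. by rewrite /enc; case: (m i) => [|[|n] l]. Qed.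

Lemma nexec_eq c m m1 m2 : nexec c m m1 -> m1 =1 m2 -> nexec c m m2.
Proof. by move=> cs /funext <-. Qed.

Lemma nexec_skip m : nexec Skip m m.
Proof. exact: exec_skip. Qed.

Lemma nexec_seq c d m m1 m2 : nexec c m m1 -> nexec d m1 m2 -> nexec (Seq c d) m m2.
Proof. exact: exec_seq. Qed.

Lemma nexec_pos i c d m m' :
  nexec (if 0 < head 0 (m i) then c else d) m m' -> nexec (If i pos c d) m m'.
Proof. by move=> h; apply: exec_if; rewrite pos_enc. Qed.

Lemma nexec_filled i c d m m' :
  nexec (if m i is [::] then d else c) m m' -> nexec (If i filled c d) m m'.
Proof. by move=> h; apply: exec_if; rewrite filled_enc; case: (m i) h. Qed.

Lemma nexec_pos_stop i c m m' : head 0 (m i) = 0 -> m =1 m' ->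
  nexec (While i pos c) m m'.
Proof. by move=> m0 /funext <-; apply: exec_while_stop; rewrite pos_enc m0. Qed.

Lemma nexec_pos_step i c m m1 m2 : 0 < head 0 (m i) -> nexec c m m1 ->
  nexec (While i pos c) m1 m2 -> nexec (While i pos c) m m2.
Proof. by move=> m0; apply: exec_while_step; rewrite pos_enc. Qed.

Lemma nexec_filled_stop i c m m' : m i = [::] -> m =1 m' ->
  nexec (While i filled c) m m'.
Proof. by move=> m0 /funext <-; apply: exec_while_stop; rewrite filled_enc m0. Qed.

Lemma nexec_filled_step i c m m1 m2 : m i != [::] -> nexec c m m1 ->
  nexec (While i filled c) m1 m2 -> nexec (While i filled c) m m2.
Proof. by move=> m0; apply: exec_while_step; rewrite filled_enc. Qed.

Definition Zero i : cmd := Push i (Some false).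
Definition Incr i : cmd := Push i (Some true).

Lemma nexec_zero i m : nexec (Zero i) m (upd m i (0 :: m i)).
Proof. by rewrite /nexec enc_upd; exact: exec_push. Qed.

Lemma nexec_incr i m n l : m i = n :: l -> nexec (Incr i) m (upd m i (n.+1 :: l)).
Proof. by move=> mi; rewrite /nexec enc_upd unariesS /= -(enc_eq mi); exact: exec_push. Qed.

Lemma nexec_decr i m n l : m i = n.+1 :: l -> nexec (Pop i) m (upd m i (n :: l)).
Proof.
move=> mi; have := exec_pop i (enc m).
by rewrite /nexec enc_upd (enc_eq mi) unariesS.
Qed.

Lemma nexec_pop0 i m l : m i = 0 :: l -> nexec (Pop i) m (upd m i l).
Proof. by move=> mi; have := exec_pop i (enc m); rewrite /nexec enc_upd (enc_eq mi). Qed.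

Lemma nexec_pred i m n l : m i = n :: l ->
  nexec (If i pos (Pop i) Skip) m (upd m i (n.-1 :: l)).
Proof.
move=> mi; apply: nexec_pos; rewrite mi; case: n mi => [|n] mi /=.
  by apply: nexec_eq; [exact: nexec_skip|upd_ext].
exact: nexec_decr.
Qed.

Definition Drop i : cmd := Seq (While i pos (Pop i)) (Pop i).

Lemma nexec_drop i m : nexec (Drop i) m (upd m i (behead (m i))).
Proof.
case mi : (m i) => [|n l].
  apply: nexec_seq; first by apply: nexec_pos_stop => //; rewrite mi.
  by have := exec_pop i (enc m); rewrite /nexec enc_upd (enc_eq mi).
apply: (nexec_seq (m1 := upd m i (0 :: l))); last first.
  by apply: (nexec_eq (nexec_pop0 (updE _ _ _))); upd_ext.
elim: n m mi => [|n IHn] m mi; first by apply: nexec_pos_stop; rewrite ?mi //; upd_ext.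
apply: nexec_pos_step; first by rewrite mi.
  exact: nexec_decr mi.
by apply: nexec_eq (IHn _ (updE _ _ _)) _; upd_ext.
Qed.

Definition Clear i : cmd := While i filled (Drop i).

Lemma nexec_clear i m : nexec (Clear i) m (upd m i [::]).
Proof.
move mi : (m i) => l; elim: l m mi => [|n l IHl] m mi.
  by apply: nexec_filled_stop => //; upd_ext.
apply: nexec_filled_step; first by rewrite mi.
  exact: nexec_drop.
by apply: (nexec_eq (IHl _ _)); rewrite ?updE ?mi //; upd_ext.
Qed.

Definition Move i j : cmd :=
  Seq (Zero j) (Seq (While i pos (Seq (Pop i) (Incr j))) (Pop i)).

Lemma ord_neq i j : i != j -> i <> j :> nat.
Proof. by move/eqP=> ij /val_inj. Qed.

Lemma nexec_transfer i j m n l k l' : i != j -> m i = n :: l -> m j = k :: l' ->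
  nexec (While i pos (Seq (Pop i) (Incr j))) m
        (upd (upd m i (0 :: l)) j (n + k :: l')).
Proof.
move=> ij; have ij' := ord_neq ij; have ji : j != i by rewrite eq_sym.
elim: n k m => [|n IHn] k m mi mj.
  by apply: nexec_pos_stop; rewrite ?mi // add0n; upd_ext.
apply: nexec_pos_step; first by rewrite mi.
  apply: nexec_seq; first exact: nexec_decr mi.
  by apply: (nexec_incr (n := k) (l := l')); upd_at.
apply: nexec_eq; first by apply: IHn; upd_at.
by rewrite addSnnS; upd_ext.
Qed.

Lemma nexec_move i j m n l : i != j -> m i = n :: l ->
  nexec (Move i j) m (upd (upd m i l) j (n :: m j)).
Proof.
move=> ij mi; have ij' := ord_neq ij; have ji : j != i by rewrite eq_sym.
apply: nexec_seq; first exact: nexec_zero.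
apply: nexec_seq.
  by apply: (nexec_transfer ij (n := n) (l := l) (k := 0) (l' := m j)); upd_at.
apply: nexec_eq; first by apply: (nexec_pop0 (l := l)); upd_at.
by rewrite addn0; upd_ext.
Qed.

(** Reading a unary number destroys it, so it is moved to [j] and [t] at once and restored from
    [t]. *)
Definition Copy (i j t : 'I_K) : cmd :=
  Seq (Zero j) (Seq (Zero t)
  (Seq (While i pos (Seq (Pop i) (Seq (Incr j) (Incr t))))
  (Seq (While t pos (Seq (Pop t) (Incr i))) (Pop t)))).

Lemma nexec_copy i j (t : 'I_K) m n l : i != j -> i != t -> j != t -> m i = n :: l ->
  nexec (Copy i j t) m (upd m j (n :: m j)).
Proof.
move=> ij it jt mi; have ij' := ord_neq ij; have ji : j != i by rewrite eq_sym.
have it' := ord_neq it; have ti : t != i by rewrite eq_sym.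
have jt' := ord_neq jt; have tj : t != j by rewrite eq_sym.
apply: nexec_seq; first exact: nexec_zero.
apply: nexec_seq; first exact: nexec_zero.
apply: (nexec_seq (m1 := upd (upd (upd m i (0 :: l)) j (n :: m j)) t (n :: m t))).
  have : forall (p : nat -> seq nat) k k', p i = n :: l -> p j = k :: m j -> p t = k' :: m t ->
    nexec (While i pos (Seq (Pop i) (Seq (Incr j) (Incr t)))) p
     (upd (upd (upd p i (0 :: l)) j (n + k :: m j)) t (n + k' :: m t)).
    elim: {mi} n => [|n IHn] p k k' pi pj pt.
      by apply: nexec_pos_stop; rewrite ?pi // !add0n; upd_ext.
    apply: nexec_pos_step; first by rewrite pi.
      apply: nexec_seq; first exact: nexec_decr pi.
      apply: nexec_seq; first by apply: (nexec_incr (n := k) (l := m j)); upd_at.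
      by apply: (nexec_incr (n := k') (l := m t)); upd_at.
    apply: nexec_eq; first by apply: (IHn _ k.+1 k'.+1); upd_at.
    by rewrite !addSnnS; upd_ext.
  move=> loop; apply: nexec_eq.
    by apply: (loop _ 0 0); upd_at.
  by rewrite !addn0; upd_ext.
apply: nexec_seq.
  by apply: (nexec_transfer ti (n := n) (l := m t) (k := 0) (l' := l)); upd_at.
apply: nexec_eq; first by apply: (nexec_pop0 (l := m t)); upd_at.
by rewrite addn0; upd_ext.
Qed.

Definition Dist i j f : cmd :=
  Seq (While i pos (Seq (Pop i) (If j pos (Pop j) (Incr f))))
  (Seq (While j pos (Seq (Pop j) (Incr f))) (Seq (Pop i) (Pop j))).

(** This is the equality test: subtraction is truncated, so the amount added is [0] exactly when
    [a = b]. Accumulating in [f] allows several comparisons to be tested together. *)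
Lemma nexec_dist i j (f : 'I_K) m a l b l' r e : i != j -> i != f -> j != f ->
  m i = a :: l -> m j = b :: l' -> m f = r :: e ->
  nexec (Dist i j f) m
    (upd (upd (upd m i l) j l') f (r + ((a - b) + (b - a)) :: e)).
Proof.
move=> ij it jt mi mj mf; have ij' := ord_neq ij; have ji : j != i by rewrite eq_sym.
have it' := ord_neq it; have ti : f != i by rewrite eq_sym.
have jt' := ord_neq jt; have tj : f != j by rewrite eq_sym.
apply: (nexec_seq (m1 := upd (upd (upd m i (0 :: l)) j (b - a :: l')) f (r + (a - b) :: e))).
  elim: a b r m mi mj mf => [|a IHa] b r m mi mj mf.
    by apply: nexec_pos_stop; rewrite ?mi // subn0 sub0n addn0; upd_ext.
  apply: nexec_pos_step; first by rewrite mi.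
    apply: nexec_seq; first exact: nexec_decr mi.
    apply: (nexec_pos (m' := if 0 < b then upd (upd m i (a :: l)) j (b.-1 :: l')
       else upd (upd m i (a :: l)) f (r.+1 :: e))).
    rewrite updN // mj /=; case: b mj => [|b] mj /=.
      by apply: nexec_incr; upd_at.
    by apply: nexec_decr; upd_at.
  case: b mj => [|b] mj /=.
    apply: nexec_eq; first by apply: (IHa 0 r.+1); upd_at.
    by rewrite addSnnS !subn0; upd_ext.
  apply: nexec_eq; first by apply: (IHa b r); upd_at.
  by rewrite !subSS; upd_ext.
apply: nexec_seq.
  by apply: (nexec_transfer jt (n := b - a) (l := l') (k := r + (a - b)) (l' := e)); upd_at.
apply: nexec_seq; first by apply: (nexec_pop0 (l := l)); upd_at.
apply: nexec_eq; first by apply: (nexec_pop0 (l := l')); upd_at.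
by rewrite addnCA [_ - _ + _]addnC; upd_ext.
Qed.

Definition Pour i j : cmd := While i filled (Move i j).

Lemma nexec_pour i j m : i != j ->
  nexec (Pour i j) m (upd (upd m i [::]) j (catrev (m i) (m j))).
Proof.
move=> ij; have ij' := ord_neq ij; have ji : j != i by rewrite eq_sym.
move mi : (m i) => l; elim: l m mi => [|a l IHl] m mi.
  by apply: nexec_filled_stop; rewrite ?mi //; upd_ext.
apply: nexec_filled_step; first by rewrite mi.
  exact: nexec_move mi.
apply: nexec_eq; first by apply: IHl; upd_at.
by rewrite updE; upd_ext.
Qed.

Definition PourCopy i j k t : cmd := While i filled (Seq (Copy i j t) (Move i k)).

Lemma nexec_pourcopy i j k t m : uniq [:: i; j; k; t] ->
  nexec (PourCopy i j k t) m
    (upd (upd (upd m i [::]) j (catrev (m i) (m j))) k (catrev (m i) (m k))).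
Proof.
rewrite /= !inE !negb_or => /and4P[/and3P[ij ik it] /andP[jk jt] kt _].
have ij' := ord_neq ij; have ji : j != i by rewrite eq_sym.
have ik' := ord_neq ik; have ki : k != i by rewrite eq_sym.
have jk' := ord_neq jk; have kj : k != j by rewrite eq_sym.
move mi : (m i) => l; elim: l m mi => [|a l IHl] m mi.
  by apply: nexec_filled_stop; rewrite ?mi //; upd_ext.
apply: nexec_filled_step; first by rewrite mi.
  apply: nexec_seq; first by apply: (nexec_copy ij it jt mi).
  by apply: (nexec_move (n := a) (l := l) ik); upd_at.
apply: nexec_eq; first by apply: IHl; upd_at.
by upd_ext.
Qed.

(** Each pour reverses a list, so restoring the source takes two. Copying during the first gives the
    reversed list; copying during the second, as in [CopyAll], gives the list itself. *)
Definition CopyRev i j x t : cmd := Seq (PourCopy i x j t) (Pour x i).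

Lemma nexec_copyrev i j x t m : uniq [:: i; x; j; t] -> m x = [::] ->
  nexec (CopyRev i j x t) m (upd m j (catrev (m i) (m j))).
Proof.
move=> u mx; apply: nexec_seq; first exact: nexec_pourcopy.
move: u; rewrite /= !inE !negb_or => /and4P[/and3P[ix ij it] /andP[xj xt] jt _].
have ix' := ord_neq ix; have xi : x != i by rewrite eq_sym.
have ij' := ord_neq ij; have ji : j != i by rewrite eq_sym.
have xj' := ord_neq xj; have jx : j != x by rewrite eq_sym.
apply: nexec_eq; first exact: nexec_pour.
have mK : catrev (catrev (m i) (m x)) [::] = m i by rewrite mx; exact: revK.
by upd_ext.
Qed.

Definition CopyAll i j x t : cmd := Seq (Pour i x) (PourCopy x i j t).

Lemma nexec_copyall i j x t m : uniq [:: x; i; j; t] -> m x = [::] -> m j = [::] ->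
  nexec (CopyAll i j x t) m (upd m j (m i)).
Proof.
move=> u mx mj; move: (u); rewrite /= !inE !negb_or => /and4P[/and3P[xi xj xt] /andP[ij it] jt _].
have xi' := ord_neq xi; have ix : i != x by rewrite eq_sym.
have ij' := ord_neq ij; have ji : j != i by rewrite eq_sym.
have xj' := ord_neq xj; have jx : j != x by rewrite eq_sym.
apply: nexec_seq; first exact: nexec_pour.
apply: nexec_eq; first exact: nexec_pourcopy.
have mK : catrev (catrev (m i) (m x)) [::] = m i by rewrite mx; exact: revK.
by upd_ext.
Qed.

(** An exhausted half tape yields [0], which is [blank]. *)
Definition Fetch i j : cmd := If i filled (Move i j) (Zero j).

Lemma nexec_fetch i j m : i != j ->
  nexec (Fetch i j) m (upd (upd m i (behead (m i))) j (head 0 (m i) :: m j)).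
Proof.
move=> ij; have ij' := ord_neq ij; apply: nexec_filled; case mi : (m i) => [|n l].
  by apply: nexec_eq; [exact: nexec_zero|upd_ext].
exact: nexec_move.
Qed.

End Exec.

(** * The universal program *)

Definition quintuple_nums (i : quintuple) : seq nat :=
  [:: cur_state i; cur_symbol i; new_state i; new_symbol i;
      nat_of_direction (head_move i)].

Definition nums (M : TM) : seq nat := flatten (map quintuple_nums M).

Lemma unaries_cat l l' : unaries (l ++ l') = unaries l ++ unaries l'.
Proof. by rewrite /unaries map_cat flatten_cat. Qed.

Lemma encode_nums M : encode M = unaries (nums M).
Proof.
elim: M => // i M IHM.
rewrite (_ : encode _ = encode_quintuple i ++ encode M) // IHM.
exact/esym/(unaries_cat (quintuple_nums i)).
Qed.

Lemma upd_nth (L : seq (seq nat)) i l :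
  upd (nth [::] L) i l = nth [::] (set_nth [::] L i l).
Proof. by apply/funext => j; rewrite nth_set_nth. Qed.

Notation ucmd := (cmd 17).

Local Notation "'reg n" := (@Ordinal 18 n isT) (at level 0, n at level 0).

Definition rIn := 'reg 0.
Definition rWord := 'reg 1.
Definition rCode := 'reg 2.
Definition rTime := 'reg 3.
Definition rHalt := 'reg 4.
Definition rW := 'reg 5.
Definition rJ := 'reg 6.
Definition rB := 'reg 7.
Definition rP := 'reg 8.
Definition rQ := 'reg 9.
Definition rA := 'reg 10.
Definition rL := 'reg 11.
Definition rR := 'reg 12.
Definition rX := 'reg 13.
Definition rF := 'reg 14.
Definition rG := 'reg 15.
Definition rT := 'reg 16.
Definition rC := 'reg 17.

(** The top of [rP] is a direction, coded [0], [1], [2] for left, stay, right. *)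
Definition MoveHead : ucmd :=
  If rP pos
    (Seq (Pop rP) (If rP pos
      (Seq (Drop rP) (Seq (Move rA rL) (Fetch rR rA)))
      (Drop rP)))
    (Seq (Drop rP) (Seq (Move rA rR) (Fetch rL rA))).

(** Clearing [rP] discards the later rows, so the first applicable quintuple wins as in [step]; the
    entry put on [rG] records that there was one. *)
Definition Apply : ucmd :=
  Seq (Drop rQ) (Seq (Move rP rQ) (Seq (Drop rA) (Seq (Move rP rA)
  (Seq MoveHead (Seq (Clear rP) (Zero rG)))))).

Definition ScanBody : ucmd :=
  Seq (Copy rQ rX rT) (Seq (Zero rF) (Seq (Dist rP rX rF)
  (Seq (Copy rA rX rT) (Seq (Dist rP rX rF)
  (If rF pos
    (Seq (Drop rF) (Seq (Drop rP) (Seq (Drop rP) (Drop rP))))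
    (Seq (Drop rF) Apply)))))).

Definition Step : ucmd :=
  Seq (CopyAll rCode rP rX rT) (Seq (While rP filled ScanBody)
  (If rG filled (Drop rG) (Incr rHalt))).

Section Universal.
Variables (word_nums : seq nat) (C : TM).

Definition ustore tt h w j b p q a l r x f g tc : nat -> seq nat :=
  nth [::] [:: [::]; word_nums; nums C; tt; h; w; j; b; p; q; a; l; r; x; f; g; [::]; tc].

Tactic Notation "next" open_constr(lem) :=
  apply: nexec_seq; [by eapply lem | rewrite ?upd_nth /=].
Tactic Notation "finish" open_constr(lem) :=
  apply: nexec_eq; [by eapply lem | by rewrite ?upd_nth /=].

Lemma nexec_moveHead tt h w j b d p q a c tc :
  nexec MoveHead
    (ustore tt h w j b (nat_of_direction d :: p) [:: q] [:: a] (left_part c)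
         (right_part c) [::] [::] [::] tc)
    (let c' := write_move q a d c in
     ustore tt h w j b p [:: Defs.state c'] [:: scanned c'] (left_part c')
         (right_part c') [::] [::] [::] tc).
Proof.
case: c => [q1 l a1 r]; case: d; rewrite /MoveHead /ustore /=; apply: nexec_pos => /=.
- next nexec_drop. next (nexec_move (n := a) (l := [::])).
  by finish nexec_fetch; case: (l).
- next (nexec_decr (n := 0) (l := p)). apply: nexec_pos => /=.
  by finish nexec_drop.
- next (nexec_decr (n := 1) (l := p)). apply: nexec_pos => /=.
  next nexec_drop. next (nexec_move (n := a) (l := [::])).
  by finish nexec_fetch; case: (r).
Qed.

Lemma nexec_apply tt h w j b q' a' d p c tc :
  nexec Apply
    (ustore tt h w j b (q' :: a' :: nat_of_direction d :: p) [:: Defs.state c]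
       [:: scanned c] (left_part c) (right_part c) [::] [::] [::] tc)
    (let c' := write_move q' a' d c in
     ustore tt h w j b [::] [:: Defs.state c'] [:: scanned c'] (left_part c')
         (right_part c') [::] [::] [:: 0] tc).
Proof.
rewrite /Apply /ustore.
next nexec_drop.
next (nexec_move (n := q') (l := a' :: nat_of_direction d :: p)).
next nexec_drop.
next (nexec_move (n := a') (l := nat_of_direction d :: p)).
next (nexec_moveHead _ _ _ _ _ d _ _ _ c).
next nexec_clear.
finish nexec_zero.
Qed.

Lemma nexec_scan tt h w j b M c tc :
  nexec (While rP filled ScanBody)
    (ustore tt h w j b (nums M) [:: Defs.state c]
       [:: scanned c] (left_part c) (right_part c) [::] [::] [::] tc)
    (let c' := odflt c (step M c) in
     ustore tt h w j b [::] [:: Defs.state c'] [:: scanned c'] (left_part c')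
         (right_part c') [::] [::] (if step M c then [:: 0] else [::]) tc).
Proof.
elim: M => [|i M IHM]; first exact: nexec_filled_stop.
have body : nexec ScanBody
    (ustore tt h w j b (nums (i :: M)) [:: Defs.state c]
       [:: scanned c] (left_part c) (right_part c) [::] [::] [::] tc)
    (if applicable c i then
      (let c' := write_move (new_state i) (new_symbol i) (head_move i) c in
      ustore tt h w j b [::] [:: Defs.state c'] [:: scanned c'] (left_part c')
         (right_part c') [::] [::] [:: 0] tc)
     else (ustore tt h w j b (nums M) [:: Defs.state c]
       [:: scanned c] (left_part c) (right_part c) [::] [::] [::] tc)).
  rewrite /ScanBody /ustore /=.
  next (nexec_copy (n := Defs.state c) (l := [::])).
  next nexec_zero.
  next (nexec_dist (a := cur_state i) (b := Defs.state c) (r := 0)).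
  next (nexec_copy (n := scanned c) (l := [::])).
  next (nexec_dist (a := cur_symbol i) (b := scanned c)).
  (* [rF] holds the distance of the states plus that of the symbols. *)
  have -> : applicable c i =
     ~~ (0 < 0 + (cur_state i - Defs.state c + (Defs.state c - cur_state i)) +
     (cur_symbol i - scanned c + (scanned c - cur_symbol i))).
    rewrite /applicable -leqNgt leqn0 !addn_eq0 /= !subn_eq0 -!eqn_leq.
    by [].
  apply: nexec_pos; rewrite [head _ _]/=; case: ifP => _ /=.
    next nexec_drop. next nexec_drop. next nexec_drop.
    by finish nexec_drop.
  next nexec_drop.
  exact: (nexec_apply _ _ _ _ _ _ _ (head_move i)).
apply: (nexec_filled_step _ body) => //.
rewrite /step /=; case: ifP => ci; last exact: IHM.
exact: nexec_filled_stop.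
Qed.

(** A halted configuration is kept and every further step is counted, so [n] steps raise the counter
    exactly when [C] halts after fewer than [n] steps. *)
Definition sim (x : config * nat) : config * nat :=
  if step C x.1 is Some c then (c, x.2) else (x.1, x.2.+1).

Lemma nexec_step tt x w j b tc :
  let m x := ustore tt [:: x.2] w j b [::] [:: Defs.state x.1]
    [:: scanned x.1] (left_part x.1) (right_part x.1) [::] [::] [::] tc in
  nexec Step (m x) (m (sim x)).
Proof.
case: x => c h /=; rewrite /Step /ustore /=.
next nexec_copyall.
next (nexec_scan _ _ _ _ _ _ c).
rewrite /sim /=; case: (step C c) => [c'|]; apply: nexec_filled => /=.
  by finish nexec_drop.
by finish (nexec_incr (n := h) (l := [::])).
Qed.

(** The number [2] pushed on the symbols of [p] is the symbol of the leading [1]; the digit of index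
    [j] then decides whether [C] gets the full time or none. *)
Definition Check : ucmd :=
  Seq (CopyRev rW rR rX rT) (Seq (Zero rR) (Seq (Incr rR) (Seq (Incr rR)
  (Seq (Copy rJ rF rT) (Seq (While rF pos (Seq (Pop rF) (Drop rR)))
  (Seq (Drop rF) (Seq (Fetch rR rA) (Seq (Clear rR)
  (Seq (If rA pos (Pop rA) Skip) (Seq (If rA pos (Copy rTime rC rT) (Zero rC))
  (Seq (Drop rA) (Seq (CopyRev rW rR rX rT) (Seq (Fetch rR rA) (Seq (Zero rQ)
  (Seq (While rC pos (Seq (Pop rC) Step)) (Seq (Drop rC) (Seq (Drop rQ)
  (Seq (Drop rA) (Seq (Clear rL) (Clear rR)))))))))))))))))))).

(** [p] is what remains of the input after removing [j] zeros; [true :: p] are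
    the binary digits of the number of [p]. *)
Definition check (t : nat) (p : word) (j h : nat) : nat :=
  (iter (if nth false (true :: p) j then t else 0) sim (initial p, h)).2.

Lemma nexec_check t p j h b :
  let m h := ustore [:: t] [:: h] (rev (map symbol_of_bit p)) [:: j] b
    [::] [::] [::] [::] [::] [::] [::] [::] [::] in
  nexec Check (m h) (m (check t p j h)).
Proof.
rewrite /= /Check /ustore.
pose s := map symbol_of_bit p; rewrite -/s.
have revs : catrev (rev s) [::] = s by exact: revK.
next nexec_copyrev; rewrite revs.
next nexec_zero.
next (nexec_incr (n := 0) (l := s)).
next (nexec_incr (n := 1) (l := s)).
next (nexec_copy (n := j) (l := [::])).
have drop_loop n (l : seq nat) : nexec (While rF pos (Seq (Pop rF) (Drop rR)))
    (ustore [:: t] [:: h] (rev s) [:: j] b [::] [::] [::] [::] l [::] [:: n] [::] [::])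
    (ustore [:: t] [:: h] (rev s) [:: j] b [::] [::] [::] [::] (drop n l) [::] [:: 0] [::] [::]).
  elim: n l => [|n IHn] l; first by rewrite drop0; exact: nexec_pos_stop.
  apply: nexec_pos_step => //.
    rewrite /ustore.
    next (nexec_decr (n := n) (l := [::])).
    exact: nexec_drop.
  rewrite /= ?upd_nth /=.
  have -> : drop n.+1 l = drop n (behead l) by case: (l) => //; rewrite drop_oversize.
  exact: IHn.
next (drop_loop j (2 :: s)).
rewrite /ustore; next nexec_drop.
next nexec_fetch. next nexec_clear.
(* The digit [0] has symbol [1] and a position out of range gives [0], so the predecessor is
   positive only for the symbol [2]. *)
have hd : (0 < (head 0 (drop j (2 :: s))).-1) = nth false (true :: p) j.
  rewrite -nth0 nth_drop addn0; case: (j) => //= n.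
  case: (ltnP n (size p)) => np; last by rewrite !nth_default ?size_map.
  by rewrite (nth_map false) //; case: (nth _ _ _).
move: (head 0 _) hd => v hd.
next nexec_pred.
apply: (nexec_seq (m1 := ustore [:: t] [:: h] (rev s) [:: j] b [::] [::] [:: v.-1]
  [::] [::] [::] [::] [::] [:: if nth false (true :: p) j then t else 0])).
  apply: nexec_pos; rewrite [head _ _]/= hd; case: (nth _ _ _).
    by finish (nexec_copy (n := t) (l := [::])).
  by finish nexec_zero.
rewrite /ustore; next nexec_drop.
next nexec_copyrev; rewrite revs.
next nexec_fetch. next nexec_zero.
pose n := if nth false (true :: p) j then t else 0.
pose m n x := ustore [:: t] [:: x.2] (rev s) [:: j] b [::] [:: Defs.state x.1]
    [:: scanned x.1] (left_part x.1) (right_part x.1) [::] [::] [::] [:: n].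
have loop k x : nexec (While rC pos (Seq (Pop rC) Step)) (m k x) (m 0 (iter k sim x)).
  elim: k x => [|k IHk] x; first exact: nexec_pos_stop.
  apply: nexec_pos_step => //.
    rewrite /m /ustore.
    next (nexec_decr (n := k) (l := [::])).
    exact: nexec_step.
  by rewrite iterSr; exact: IHk.
next (loop n (initial p, h)).
rewrite /m /ustore; next nexec_drop.
next nexec_drop. next nexec_drop. next nexec_clear.
by finish nexec_clear.
Qed.

(** Bits have positive symbols, so the outer test detects a nonempty candidate and the inner one a
    last letter [1], which is then restored. Only trailing zeros are removed; otherwise dropping the
    flag [rB] ends the loop. *)
Definition Advance : ucmd :=
  If rW pos
    (Seq (Pop rW) (If rW pos (Seq (Incr rW) (Drop rB)) (Seq (Drop rW) (Incr rJ))))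
    (Drop rB).

(** [v] is a candidate read backwards. *)
Fixpoint search (t : nat) (v : word) (j h : nat) : nat :=
  let h' := check t (rev v) j h in
  if v is false :: v' then search t v' j.+1 h' else h'.

Lemma nexec_search t v j h : exists w' j',
  nexec (While rB filled (Seq Check Advance))
    (ustore [:: t] [:: h] (map symbol_of_bit v) [:: j] [:: 0]
       [::] [::] [::] [::] [::] [::] [::] [::] [::])
    (ustore [:: t] [:: search t v j h] w' [:: j'] [::]
       [::] [::] [::] [::] [::] [::] [::] [::] [::]).
Proof.
elim: v j h => [|a v IHv] j h.
  have chk := nexec_check t [::] j h [:: 0].
  rewrite /= in chk.
  exists [::], j; apply: nexec_filled_step => //.
    next chk.
    by apply: nexec_pos => /=; exact: nexec_drop.
  by apply: nexec_filled_stop; rewrite /ustore ?upd_nth.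
have chk := nexec_check t (rev (a :: v)) j h [:: 0].
rewrite /= map_rev revK /= in chk.
case: a chk => chk /=.
  exists (map symbol_of_bit (true :: v)), j; apply: nexec_filled_step => //.
    next chk.
    apply: nexec_pos; rewrite /ustore /=.
    next (nexec_decr (n := 1) (l := map symbol_of_bit v)).
    apply: nexec_pos; rewrite /=.
    next (nexec_incr (n := 1) (l := map symbol_of_bit v)).
    exact: nexec_drop.
  by apply: nexec_filled_stop; rewrite /ustore ?upd_nth.
have [w' [j' IH]] := IHv j.+1 (check t (rev (false :: v)) j h).
exists w', j'; apply: (nexec_filled_step _ _ IH) => //.
next chk.
apply: nexec_pos; rewrite /ustore /=.
next (nexec_decr (n := 0) (l := map symbol_of_bit v)).
apply: nexec_pos; rewrite /=.
next nexec_drop.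
by finish (nexec_incr (n := j) (l := [::])).
Qed.

Definition Round : ucmd :=
  Seq (Incr rTime) (Seq (CopyRev rWord rW rX rT) (Seq (Zero rJ) (Seq (Zero rB)
  (Seq (While rB filled (Seq Check Advance)) (Seq (Drop rJ) (Clear rW)))))).

Lemma nexec_round w t h : word_nums = map symbol_of_bit w ->
  let m t h := ustore [:: t] [:: h] [::] [::] [::]
       [::] [::] [::] [::] [::] [::] [::] [::] [::] in
  nexec Round (m t h) (m t.+1 (search t.+1 (rev w) 0 h)).
Proof.
move=> wn; rewrite /= /Round /ustore.
next (nexec_incr (n := t) (l := [::])).
next nexec_copyrev.
next nexec_zero. next nexec_zero.
rewrite wn [catrev _ _](_ : _ = map symbol_of_bit (rev w)); last by rewrite map_rev.
have [w' [j' loop]] := nexec_search t.+1 (rev w) 0 h.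
rewrite -wn; next loop.
rewrite /ustore; next nexec_drop.
by finish nexec_clear.
Qed.

End Universal.

(** * What the search detects *)

Lemma iter_sim_le C n x : x.2 <= (iter n (sim C) x).2.
Proof.
elim: n => // n IHn; apply: leq_trans IHn _; rewrite iterS /sim.
by case: (step _ _) => [c|] //=.
Qed.

Lemma iter_simP C n c h : reflect
  (exists t c', [/\ t < n, run C t c = Some c' & step C c' = None])
  (h < (iter n (sim C) (c, h)).2).
Proof.
apply: (iffP idP).
  elim: n c => [|n IHn] c /=; first by rewrite ltnn.
  rewrite -iterS iterSr /sim -/(sim C) /=; case E: (step C c) => [c'|].
    move=> /IHn[t [d [tn run_d stop_d]]]; exists t.+1, d; split=> //.
    by rewrite /run iterSr /= E.
  by move=> _; exists 0, c.
elim: n c => [|n IHn] c [t [d [tn run_d stop_d]]] //.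
rewrite iterSr /sim -/(sim C) /=; case E: (step C c) => [c'|].
  apply: IHn; case: t tn run_d => [|t] tn.
    by case=> cd; rewrite cd stop_d in E.
  by rewrite /run iterSr /= E => run_d; exists t, d.
exact: leq_trans (ltnSn h) (iter_sim_le _ _ (c, h.+1)).
Qed.

Definition halts_within C t p :=
  exists n c, [/\ n < t, run C n (initial p) = Some c & step C c = None].

(** The default [false] bounds [j] by [size p]; the leading [true] always admits [j = 0]. *)
Definition padding (p : word) : set word :=
  [set p ++ nseq j false | j in [set j | nth false (true :: p) j]].

Lemma check_le C t p j h : h <= check C t p j h.
Proof. exact: iter_sim_le. Qed.

Lemma checkP C t p j h : reflect
  (nth false (true :: p) j /\ halts_within C t p) (h < check C t p j h).
Proof.
rewrite /check; case: (nth _ _ _).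
  by apply: (iffP (iter_simP _ _ _ _)) => [|[]].
by rewrite ltnn; constructor => -[].
Qed.

Lemma search_le C t v j h : h <= search C t v j h.
Proof.
elim: v j h => [|[] v IHv] j h /=; try exact: check_le.
exact: leq_trans (check_le _ _ _ _ _) (IHv _ _).
Qed.

(** No check lowers the counter, so it ends above [h] exactly when some check raises it. *)
Lemma searchP C t v j h : h < search C t v j h <->
  exists i v', [/\ v = nseq i false ++ v', nth false (true :: rev v') (j + i) &
                   halts_within C t (rev v')].
Proof.
elim: v j h => [|a v IHv] j h /=.
  split=> [/checkP[jn ht]|[i [v' [vE jn ht]]]].
    by exists 0, [::]; rewrite addn0.
  case: i vE jn => //= vE; rewrite addn0 => jn.
  by rewrite -vE in jn ht; apply/checkP.
case: a => /=.
  split=> [/checkP[jn ht]|[i [v' [vE jn ht]]]].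
    by exists 0, (true :: v); rewrite addn0.
  case: i vE jn => //= vE; rewrite addn0 => jn.
  by rewrite -vE in jn ht; apply/checkP.
split=> [hs|[[|i] [v' [/= vE jn ht]]]].
- case: (ltnP h (check C t (rev (false :: v)) j h)) => [/checkP[jn ht]|hc].
    by exists 0, (false :: v); rewrite addn0.
  have /IHv[i [v' [-> jn ht]]] := leq_ltn_trans hc hs.
  by exists i.+1, v'; rewrite addnS -addSn.
- apply: leq_trans (search_le _ _ _ _ _); apply/checkP.
  by rewrite vE; rewrite addn0 in jn.
- apply: leq_ltn_trans (check_le _ _ (rev (false :: v)) j h) _.
  by apply/IHv; exists i, v'; case: vE => ->; rewrite addSnnS.
Qed.

(** * Loading the input, and the domain of the universal program *)

Definition bit (o : option letter) : bool := if o is Some (Some _) then true else false.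

(** The last input letter is on top and is treated first, which puts the first one on top of
    [rWord]; the loop stops at the separator. *)
Definition LoadWord : ucmd :=
  While rIn bit
    (Seq (If rIn pos
       (Seq (Push rWord (Some false))
          (Seq (Push rWord (Some true)) (Push rWord (Some true))))
       (Seq (Push rWord (Some false)) (Push rWord (Some true))))
    (Pop rIn)).

(** Two spills preserve the order, and [encode C] already is the unary form of [nums C]. *)
Definition Load : ucmd :=
  Seq LoadWord
  (Seq (Pop rIn) (Seq (Spill rIn rX) (Spill rX rCode))).

Lemma exec_load C w :
  exec Load (start_store (None :: map Some (encode C)) w)
       (enc (ustore (map symbol_of_bit w) C [::] [::] [::] [::] [::]
               [::] [::] [::] [::] [::] [::] [::] [::] [::])).
Proof.
pose rest : seq letter := map Some (encode C).
have load l (s : store) : s rIn = map Some l ++ None :: rest ->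
    exec LoadWord s (upd (upd s rIn (None :: rest)) rWord
       (map Some (unaries (map symbol_of_bit (rev l))) ++ s rWord)).
  elim: l s => [|b l IHl] s sIn.
    apply: exec_while_eq => [|i]; first by rewrite sIn.
    by rewrite /upd; case: eqP => [->|] //; case: eqP => [->|].
  apply: exec_while_step; first by rewrite sIn.
    apply: exec_seq (exec_pop _ _).
    apply: (exec_if (s' := upd s rWord (map Some (unary (symbol_of_bit b)) ++ s rWord))).
    rewrite sIn /=; case: (b) => /=.
      apply: exec_seq; first exact: exec_push.
      apply: exec_seq; first exact: exec_push.
      by apply: exec_eq; [exact: exec_push|move=> i; rewrite /upd /=; case: eqP].
    apply: exec_seq; first exact: exec_push.
    by apply: exec_eq; [exact: exec_push|move=> i; rewrite /upd /=; case: eqP].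
  apply: exec_eq; first by apply: IHl; rewrite /upd /= sIn.
  have unary1 n : unaries [:: n] = unary n by exact: cats0.
  move=> i; rewrite rev_cons map_rcons -cats1 unaries_cat unary1 map_cat -catA /upd /=.
  by do ?case: eqP.
apply: exec_seq.
  by apply: (load (rev w)); rewrite /start_store /upd /= map_rev.
rewrite revK.
apply: exec_seq; first exact: exec_pop.
apply: exec_seq; first exact: exec_spill.
apply: exec_eq; first exact: exec_spill.
move=> i; do 18?[case: i => [|i] //]; rewrite /enc /upd /=.
- by rewrite cats0.
- by rewrite -encode_nums; exact: revK.
- by rewrite /ustore /= nth_nil.
Qed.

Definition zero (o : option letter) : bool := o == Some (Some false).

Definition Init : ucmd := Seq Load (Seq (Zero rTime) (Zero rHalt)).

Definition Universal : ucmd := Seq Init (While rHalt zero Round).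

Section UniversalSpec.
Variables (C : TM) (w : word).

Let start := start_store (None :: map Some (encode C)) w.
Let m t h := enc (ustore (map symbol_of_bit w) C [:: t] [:: h] [::] [::] [::]
       [::] [::] [::] [::] [::] [::] [::] [::] [::]).

Lemma exec_init : exec Init start (m 0 0).
Proof.
apply: exec_seq; first exact: exec_load.
rewrite -/(nexec _ _ _); apply: nexec_seq; first exact: nexec_zero.
by apply: nexec_eq; [exact: nexec_zero|rewrite /ustore ?upd_nth /= ?upd_nth].
Qed.

Lemma exec_round t h : exec Round (m t h) (m t.+1 (search C t.+1 (rev w) 0 h)).
Proof. exact: nexec_round. Qed.

Lemma universal_halts t : 0 < search C t.+1 (rev w) 0 0 ->
  exists s, exec Universal start s.
Proof.
move=> found; suff [s loop] : exists s, exec (While rHalt zero Round) (m 0 0) s.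
  by exists s; exact: exec_seq exec_init loop.
(* The start is generalized to any time [u] with counter [0]; a round before the given one may
   succeed, and the loop then stops there. *)
suff loop u : 0 < search C (u + t).+1 (rev w) 0 0 ->
    exists s, exec (While rHalt zero Round) (m u 0) s by exact: loop.
elim: t {found} u => [|t IHt] u.
  rewrite addn0 => found; exists (m u.+1 (search C u.+1 (rev w) 0 0)).
  apply: exec_while_step; [by []|exact: exec_round|].
  by apply: exec_while_stop; move: found; case: (search _ _ _ _ _).
rewrite addnS -addSn => /IHt [s loop].
case E: (search C u.+1 (rev w) 0 0) => [|h].
  exists s; apply: exec_while_step loop; first by [].
  by have := exec_round u 0; rewrite E.
exists (m u.+1 h.+1); apply: (exec_while_step (s1 := m u.+1 h.+1)) => //.
  by have := exec_round u 0; rewrite E.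
exact: exec_while_stop.
Qed.

Lemma universal_diverges : (forall t, search C t.+1 (rev w) 0 0 = 0) ->
  forall n, exists2 k, n <= k & iter k (obind cstep) (Some ([:: Universal], start)).
Proof.
move=> none n; suff [k nk E] : exists2 k, n <= k &
  iter k (obind cstep) (Some ([:: Universal], start)) = Some ([:: While rHalt zero Round], m n 0).
  by exists k; rewrite // E.
elim: n => [|n [k nk IHn]].
  have [k E] := exec_init [:: While rHalt zero Round].
  by exists k.+2; rewrite // iterSr.
have [l E] := exec_round n 0 [:: While rHalt zero Round].
exists (l.+2 + k).
  by rewrite addSn ltnS (leq_trans nk) // leq_addl.
apply: iter_obind_add IHn _; rewrite iterSr; move: E.
by rewrite none.
Qed.

End UniversalSpec.

Definition tuatara_of (C : TM) : TM := compile Universal (None :: map Some (encode C)).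

(** A round treats finitely many candidates for a bounded time, so it terminates and every time
    bound is eventually reached unless the program has halted before. *)
Lemma dom_tuatara_of C : dom (tuatara_of C) = \bigcup_(p in dom C) padding p.
Proof.
apply/seteqP; split=> w.
  move=> wV; have [t found] : exists t, 0 < search C t.+1 (rev w) 0 0.
    apply: contrapT => none; apply: compile_diverges wV.
    apply: universal_diverges => t; apply/eqP; rewrite -leqn0 leqNgt.
    by apply/negP => found; apply: none; exists t.
  move/searchP: found => [i [v [wE wi [n [c [_ run_c stop_c]]]]]].
  exists (rev v); first by exists (output c), n, c.
  by exists i => //; rewrite -[w]revK wE rev_cat rev_nseq.
move=> [p [y [t [c [run_c stop_c _]]]] [j pj <-]].
have /universal_halts[s] : 0 < search C t.+1 (rev (p ++ nseq j false)) 0 0.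
  apply/searchP; exists j, (rev p); rewrite rev_cat rev_nseq revK; split=> //.
  by exists t, c.
move=> /(_ [::])[n run_U].
have [u [d [run_d stop_d _]]] := compile_halts run_U.
by exists (output d), u, d.
Qed.

(** * The translation of machines *)

Lemma encode_quintupleE q a q' a' d : encode_quintuple (Quintuple q a q' a' d) =
  unary q ++ unary a ++ unary q' ++ unary a' ++ unary (nat_of_direction d).
Proof. by rewrite /encode_quintuple /= cats0. Qed.

Lemma encode_cons i M : encode (i :: M) = encode_quintuple i ++ encode M.
Proof. by []. Qed.

Definition rOut := rIn.
Definition rSrc := 'reg 1.
Definition rCount := 'reg 2.
Definition rTmp := 'reg 3.

(** The output has its last letter on top, as [compile_computes] requires; the row counter is a bare
    block of [n] letters without terminator. *)
Definition tstore (o l : word) (n : nat) : store :=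
  nth [::] [:: rev (map Some o); map Some l; nseq n (Some true)].

Lemma tstore0 o l n : tstore o l n 0 = rev (map Some o).
Proof. by []. Qed.

Definition Emit (w : word) : ucmd :=
  foldr (fun b => Seq (Push rOut (Some b))) Skip w.

Lemma exec_emit w o l n : exec (Emit w) (tstore o l n) (tstore (o ++ w) l n).
Proof.
elim: w o => [|b w IHw] o; first by rewrite cats0; exact: exec_skip.
apply: exec_seq; first exact: exec_push.
have -> : upd (tstore o l n) rOut (Some b :: tstore o l n rOut) = tstore (rcons o b) l n.
  by apply/funext => -[|i] //; rewrite /tstore /upd /= map_rcons rev_rcons.
by rewrite -cat_rcons; exact: IHw.
Qed.

Definition EmitCount : ucmd :=
  Seq (While rCount filled (Seq (Pop rCount)
        (Seq (Push rTmp (Some true)) (Push rOut (Some true)))))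
      (Spill rTmp rCount).

Lemma exec_emitCount o l n :
  exec EmitCount (tstore o l n) (tstore (o ++ nseq n true) l n).
Proof.
pose s k o : store :=
  nth [::] [:: rev (map Some o); map Some l; nseq k (Some true); nseq (n - k) (Some true)].
have loop k : k <= n -> exec (While rCount filled (Seq (Pop rCount)
        (Seq (Push rTmp (Some true)) (Push rOut (Some true)))))
    (s k o) (s 0 (o ++ nseq k true)).
  elim: k o => [|k IHk] o' kn; first by rewrite cats0; exact: exec_while_stop.
  apply: (exec_while_step (s1 := s k (rcons o' true))) => //; last first.
    by rewrite -cat_rcons; exact: IHk (ltnW kn).
  apply: exec_seq; first exact: exec_pop.
  apply: exec_seq; first exact: exec_push.
  apply: exec_eq; first exact: exec_push.
  move=> i; do 4?[case: i => [|i] //]; rewrite /s /upd /= ?nth_nil //.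
    by rewrite map_rcons rev_rcons.
  by rewrite -[n - k]prednK ?subn_gt0 // -subnS.
apply: (exec_seq (s1 := s 0 (o ++ nseq n true))).
  have -> : tstore o l n = s n o.
    apply/funext => i; do 4?[case: i => [|i] //]; rewrite /s /tstore /= ?nth_nil //.
    by rewrite subnn.
  exact: loop.
apply: exec_eq; first exact: exec_spill.
move=> i; do 4?[case: i => [|i] //]; rewrite /s /tstore /upd /= ?nth_nil //.
by rewrite subn0 -/(rev _) rev_nseq.
Qed.

Section Translator.
(** [N], [f]: the number of states and the cell codes of the machine produced;
    [A], [B]: the parts of its description which do not depend on the input. *)
Variables (N : nat) (f : letter -> nat) (A B : word).

Definition EmitState : ucmd :=
  Seq (Emit (nseq N true)) (Seq EmitCount (Emit [:: false])).

Lemma exec_emitState o l n :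
  exec EmitState (tstore o l n) (tstore (o ++ unary (N + n)) l n).
Proof.
apply: exec_seq; first exact: exec_emit.
apply: exec_seq; first exact: exec_emitCount.
by rewrite /unary nseqD -cats1 !catA; exact: exec_emit.
Qed.

Definition trow (n : nat) (a : letter) : quintuple :=
  Quintuple (N + n) blank (N + n.+1) (f a) Left.

(** The counter is incremented between the two states, [N + n] and [N + n.+1]. *)
Definition EmitRow (a : letter) : ucmd :=
  Seq EmitState (Seq (Emit (unary blank)) (Seq (Push rCount (Some true))
  (Seq EmitState (Emit (unary (f a) ++ unary 0))))).

Lemma exec_emitRow a o l n :
  exec (EmitRow a) (tstore o l n) (tstore (o ++ encode_quintuple (trow n a)) l n.+1).
Proof.
apply: exec_seq; first exact: exec_emitState.
apply: exec_seq; first exact: exec_emit.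
apply: (exec_seq (s1 := tstore ((o ++ unary (N + n)) ++ unary blank) l n.+1)).
  by apply: exec_eq; [exact: exec_push|move=> [|[|[|i]]]].
apply: exec_seq; first exact: exec_emitState.
apply: exec_eq; first exact: exec_emit.
by move=> i; rewrite encode_quintupleE !catA.
Qed.

Definition EmitRows : ucmd :=
  While rSrc filled (Switch rSrc (fun a => Seq (Pop rSrc) (EmitRow a))).

Definition trows (n : nat) (l : seq letter) : TM :=
  [seq trow i (nth None l (i - n)) | i <- iota n (size l)].

Lemma trows_cons n a l : trows n (a :: l) = trow n a :: trows n.+1 l.
Proof.
rewrite /trows /= subnn; congr cons; apply/eq_in_map => i.
by rewrite mem_iota => /andP[ni _]; rewrite -(subnSK ni).
Qed.

Lemma exec_emitRows o l n :
  exec EmitRows (tstore o l n)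
    (tstore (o ++ encode (trows n (map Some l))) [::] (size l + n)).
Proof.
elim: l o n => [|b l IHl] o n.
  by rewrite cats0; exact: exec_while_stop.
apply: (exec_while_step (s1 := tstore (o ++ encode_quintuple (trow n (Some b))) l n.+1)) => //.
  apply: (exec_switch (a := Some b) (l := map Some l)) => //.
  apply: (exec_seq (s1 := tstore o l n)); last exact: exec_emitRow.
  by apply: exec_eq; [exact: exec_pop|move=> [|[|[|i]]]].
rewrite [map _ _]/= trows_cons encode_cons catA.
by rewrite [size _]/= addSnnS; exact: IHl.
Qed.

(** The spill brings the first input letter to the top. The last [EmitState] opens the origin row,
    whose state depends on the length of the input. The counter is emptied at the end so that only
    track [0] remains. *)
Definition translator : ucmd :=
  Seq (Spill rIn rSrc) (Seq (Emit A) (Seq (EmitRow None) (Seq EmitRows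
  (Seq EmitState (Seq (Emit B) (While rCount filled (Pop rCount))))))).

Lemma exec_translator w :
  exec translator (start_store [::] w)
    (tstore (A ++ encode (trows 0 (None :: map Some w)) ++ unary (N + (size w).+1) ++ B) [::] 0).
Proof.
apply: (exec_seq (s1 := tstore [::] w 0)).
  apply: exec_eq; first exact: exec_spill.
  move=> [|[|[|i]]] //; rewrite /start_store /tstore /upd /= ?nth_nil // cats0.
  exact: revK.
apply: exec_seq; first exact: exec_emit.
apply: exec_seq; first exact: exec_emitRow.
apply: exec_seq; first exact: exec_emitRows.
apply: exec_seq; first exact: exec_emitState.
apply: exec_seq; first exact: exec_emit.
rewrite trows_cons encode_cons !catA addn1.
move: (_ ++ B) => o; elim: (size w).+1 => [|n IHn]; first exact: exec_while_stop.
apply: (exec_while_step _ _ IHn) => //.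
by apply: exec_eq; [exact: exec_pop|move=> [|[|[|i]]]].
Qed.

End Translator.

Lemma encode_cat M M' : encode (M ++ M') = encode M ++ encode M'.
Proof. by rewrite /encode map_cat flatten_cat. Qed.

(** The second constant starts with the last four entries of [origin_row]: the first [unary 1] is
    the initial program state, the second is [Stay]. *)
Definition translate : ucmd :=
  translator (nstates Universal) (fun a => code (single 17 (Some a)))
    (encode (start_rows Universal))
    (unary blank ++ unary 1 ++ unary (code (None : cell 17)) ++ unary 1
       ++ encode (table Universal)).

Lemma computes_tuatara_of C :
  computes (compile translate [::]) (encode C) (encode (tuatara_of C)).
Proof.
have [n E] := exec_translator (nstates Universal) (fun a => code (single 17 (Some a)))
  (encode (start_rows Universal)) (unary blank ++ unary 1 ++ unary (code (None : cell 17)) ++ unary 1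
       ++ encode (table Universal)) (encode C) [::].
apply: (compile_computes E); last by move=> [|[|i]] //; exact: nth_nil.
rewrite tstore0; congr (rev (map Some _)).
rewrite /tuatara_of /compile !encode_cat; congr (_ ++ _).
have -> : pre_rows Universal (None :: map Some (encode C)) =
   trows (nstates Universal) (fun a => code (single 17 (Some a))) 0 (None :: map Some (encode C)).
  by rewrite /trows /pre_rows; apply: eq_map => i; rewrite subn0.
congr (_ ++ _).
rewrite -cat1s encode_cat !catA; congr (_ ++ _).
have -> : size (None :: map Some (encode C) : seq letter) = (size (encode C)).+1.
  by rewrite [LHS]/= size_map.
by rewrite encode_cons cats0 encode_quintupleE !catA.
Qed.

(** * The sums *)

Import Order.TTheory GRing.Theory Num.Theory.

(** * The inverse of [bin] *)

Definition value (q : word) : nat := foldl (fun n (b : bool) => n.*2 + b) 0 q.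

Lemma value_rcons q b : value (rcons q b) = (value q).*2 + b.
Proof. by rewrite /value foldl_rcons. Qed.

Lemma value_zeros q j : value (q ++ nseq j false) = value q * 2 ^ j.
Proof.
elim: j => [|j IHj]; first by rewrite cats0 muln1.
by rewrite -addn1 nseqD catA cats1 value_rcons IHj addn0 -muln2 -mulnA -expnSr addn1.
Qed.

Lemma value_gt0 p : 0 < value (true :: p).
Proof.
elim/last_ind: p => // p b IHp.
by rewrite -rcons_cons value_rcons addn_gt0 double_gt0 IHp.
Qed.

Lemma bin_double n (b : bool) : 0 < n -> bin (n.*2 + b) = rcons (bin n) b.
Proof.
move=> n0; rewrite /bin.
have -> : trunc_log 2 (n.*2 + b) = (trunc_log 2 n).+1.
  rewrite trunc_log2S; first by rewrite addnC half_bit_double.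
  by case: n n0 => // n _; rewrite doubleS.
rewrite -[(trunc_log 2 n).+1]add1n iotaD /= rev_cons map_rcons.
rewrite divn1 oddD odd_double oddb; congr rcons.
rewrite (iotaDl 1 0) -map_rev -map_comp; apply: eq_map => i /=.
by rewrite expnS divnMA divn2 addnC half_bit_double.
Qed.

Lemma bin_value p : bin (value (true :: p)) = p.
Proof.
elim/last_ind: p => [|p b IHp]; first by rewrite /bin trunc_log1.
by rewrite -rcons_cons value_rcons bin_double ?value_gt0 // IHp.
Qed.

Lemma value_bin n : 0 < n -> value (true :: bin n) = n.
Proof.
elim/ltn_ind: n => n IHn n0; case: (ltnP 1 n) => [n1|n1]; last first.
  have -> : n = 1 by apply/eqP; rewrite eqn_leq n1.
  by rewrite /bin trunc_log1.
have [m [b [nE m0 mn]]] : exists m (b : bool), [/\ n = m.*2 + b, 0 < m & m < n].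
  exists n./2, (odd n); split; rewrite ?half_gt0 //.
    by rewrite addnC odd_double_half.
  by rewrite -divn2 ltn_Pdiv.
by rewrite nE bin_double // -rcons_cons value_rcons IHn.
Qed.

(** * Positions of ones and padded words *)

Definition ones (p : word) : seq nat :=
  [seq j <- iota 0 (size p).+1 | nth false (true :: p) j].

Lemma mem_ones p j : (j \in ones p) = nth false (true :: p) j.
Proof.
rewrite mem_filter mem_iota /= add0n; case: (ltnP j (size p).+1) => jp.
  by rewrite andbT.
by rewrite andbF nth_default //.
Qed.

Lemma size_ones p : size (ones p) = (HW p).+1.
Proof.
rewrite size_filter -(count_map _ id) -/(mkseq _ (size (true :: p))) mkseq_nth.
by rewrite /= add1n /HW; congr _.+1; apply: eq_count => -[].
Qed.

Lemma padding_inj p i j : p ++ nseq i false = p ++ nseq j false -> i = j.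
Proof. by move/(congr1 size); rewrite !size_cat !size_nseq => /addnI. Qed.

(** The ones of [1p] are those of [p] and the leading one; different positions give padded words of
    different lengths. *)
Lemma card_padding p : padding p #= `I_(HW p).+1.
Proof.
pose f i := p ++ nseq (nth 0 (ones p) i) false.
have -> : padding p = f @` `I_(HW p).+1.
  apply/seteqP; split=> [_ [j /= + <-]|_ [i /= + <-]].
    rewrite -mem_ones => jp; exists (index j (ones p)); last by rewrite /f nth_index.
    by rewrite -size_ones index_mem.
  by rewrite -size_ones => ip; exists (nth 0 (ones p) i); rewrite //= -mem_ones mem_nth.
apply: inj_card_eq => i j; rewrite !inE -size_ones /= => ip jp /padding_inj /eqP.
by rewrite nth_uniq ?filter_uniq ?iota_uniq // => /eqP.
Qed.

Lemma padding_self p : padding p p.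
Proof. by exists 0; rewrite //= cats0. Qed.

(** Both are initial segments of the same word, so the shorter is a prefix of the longer. *)
Lemma padding_prefix p q i j :
  p ++ nseq i false = q ++ nseq j false -> prefix p q \/ prefix q p.
Proof.
move=> E; case: (leqP (size p) (size q)) => pq; [left|right].
  move: (congr1 (take (size p)) E); rewrite take_size_cat // takel_cat // => ->.
  exact: prefix_take.
move: (congr1 (take (size q)) E); rewrite takel_cat ?(ltnW pq) // take_size_cat // => <-.
exact: prefix_take.
Qed.

Lemma padding_disjoint C p q w : self_delimiting C -> dom C p -> dom C q ->
  padding p w -> padding q w -> p = q.
Proof.
move=> sd Cp Cq [i _ <-] [j _ /esym/padding_prefix[pq|qp]]; first exact: sd.
by apply/esym; exact: sd.
Qed.

(** * Kraft's inequality and the equality of the two sums *)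

Section Sums.
Variable R : realType.
Local Open Scope ring_scope.

(** In a nonempty [q] of length [n], the digit of index [j] has weight [2 ^ (n - 1 - j)] in
    [value q]; division by [2 ^ (n - 1)] turns it into [2 ^- j]. *)
Lemma sum_ones q :
  \sum_(0 <= j < size q | nth false q j) (2%:R ^- j : R) =
  (value q)%:R * 2%:R / 2%:R ^+ size q.
Proof.
elim/last_ind: q => [|q b IHq]; first by rewrite big_nil !mul0r.
rewrite big_mkcond size_rcons big_nat_recr //= nth_rcons ltnn eqxx value_rcons.
rewrite (eq_big_nat _ _ (F2 := fun j => if nth false q j then 2%:R ^- j else 0)); last first.
  by move=> j /andP[_ jq]; rewrite nth_rcons jq.
rewrite -big_mkcond IHq natrD -muln2 natrM exprS.
have : 2%:R ^+ size q != 0 :> R by rewrite expf_eq0 pnatr_eq0 andbF.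
by case: b => /= ?; field.
Qed.

Lemma sum_padding p :
  \sum_(j <- ones p) ((value (true :: (p ++ nseq j false)))%:R^-1 : R) = 2%:R ^- size p.
Proof.
rewrite big_filter -[iota _ _]/(index_iota 0 (size (true :: p))).
under eq_bigr do rewrite -cat_cons value_zeros natrM natrX invfM.
rewrite -mulr_sumr sum_ones [size (_ :: _)]/= exprS.
have : 2%:R ^+ size p != 0 :> R by rewrite expf_eq0 pnatr_eq0 andbF.
have : (value (true :: p))%:R != 0 :> R by rewrite pnatr_eq0 -lt0n value_gt0.
by move=> v0 p0; field; rewrite v0 p0.
Qed.

(** By induction on a bound for the lengths: the words with a given first bit, deprived of it, are
    again prefix-free, so they contribute at most one half. The empty word, if present, is a prefix
    of all others and hence alone. *)
Lemma kraft (r : seq word) : uniq r ->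
  (forall p q, p \in r -> q \in r -> prefix p q -> p = q) ->
  \sum_(p <- r) (2%:R ^- size p : R) <= 1.
Proof.
have [n] : exists n, all (fun p : word => size p <= n)%N r.
  exists (\max_(p <- r) size p)%N; apply/allP => p pr.
  exact: leq_bigmax_seq.
have small s : uniq s -> {subset s <= [:: [::]]} ->
    \sum_(p <- s) (2%:R ^- size p : R) <= 1.
  move=> us sub; have := uniq_leq_size us sub.
  case: s {us} sub => [|p [|q s]] //= sub _; first by rewrite big_nil ler01.
  have := sub p (mem_head _ _); rewrite inE => /eqP ->.
  by rewrite big_seq1 expr0 invr1.
elim: n r => [|n IHn] r rn ur pf.
  apply: small => // p /(allP rn) /=.
  by rewrite leqn0 size_eq0 inE.
case: (boolP ([::] \in r)) => [r0|r0].
  by apply: small => // p pr; rewrite inE -(pf [::] p) // prefix0s.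
pose half b := [seq behead p | p <- r & ohead p == Some b].
have halfP b p : (p \in half b) = (b :: p \in r).
  apply/mapP/idP => [[[|c q]] /=|bp].
  - by rewrite mem_filter.
  - by rewrite mem_filter /= => /andP[/eqP[->] qr] ->.
  - by exists (b :: p); rewrite // mem_filter /= eqxx.
have sum_half b : \sum_(p <- r | ohead p == Some b) (2%:R ^- size p : R) <= 2%:R^-1.
  rewrite -big_filter.
  rewrite (eq_big_seq (fun p => 2%:R^-1 * 2%:R ^- size (behead p))); last first.
    by move=> [|c p]; rewrite mem_filter //= => _; rewrite exprS invfM.
  rewrite -big_distrr -(big_map behead xpredT (fun p => 2%:R ^- size p)) -/(half b).
  rewrite -[leRHS]mulr1 ler_wpM2l ?invr_ge0 ?ler0n //; apply: IHn.
  - by apply/allP => p; rewrite halfP => /(allP rn).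
  - rewrite map_inj_in_uniq ?filter_uniq // => -[|c p] [|d q]; rewrite !mem_filter //=.
    by move=> /andP[/eqP[->] _] /andP[/eqP[->] _] ->.
  - move=> p q; rewrite !halfP => pr qr pq.
    by have [] : b :: p = b :: q by apply: pf; rewrite //= eqxx.
rewrite (bigID (fun p => ohead p == Some true)) /=.
rewrite [X in _ + X](_ : _ = \sum_(p <- r | ohead p == Some false) 2%:R ^- size p); last first.
  rewrite big_seq_cond [RHS]big_seq_cond; apply: eq_bigl => -[|[] p] //=.
  by rewrite (negPf r0).
by have := lerD (sum_half true) (sum_half false); lra.
Qed.

Local Open Scope ereal_scope.

(** [esum] is the supremum of its finite partial sums, to which [kraft] applies. *)
Lemma Omega_le1 C : self_delimiting C -> Omega R C <= 1.
Proof.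
move=> sd; apply: ge_ereal_sup => _ [A [Afin AC] <-].
rewrite fsbig_finite // sumEFin lee_fin; apply: kraft; first exact: finmap.fset_uniq.
by move=> p q; rewrite !in_fset_set // !inE => /AC Cp /AC Cq; exact: sd.
Qed.

(** The integers in the first sum are reindexed by pairs [(p, j)], injectively because [dom C] is
    prefix-free; summing over [j] first leaves the term of [p] in [Omega]. *)
Lemma zeta_padding C V : self_delimiting C ->
  dom V = \bigcup_(p in dom C) padding p -> zeta R V = Omega R C.
Proof.
move=> sd domV; rewrite /zeta /Omega.
pose J p := [set j | nth false (true :: p) j].
pose e (k : word * nat) := value (true :: (k.1 ++ nseq k.2 false)).
rewrite (reindex_esum (dom C `*`` J) _ e); last first.
  split.
  - move=> [p j] [/= Cp pj]; split; first exact: value_gt0.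
    by rewrite /e /= bin_value domV; exists p => //; exists j.
  - move=> [p i] [q j]; rewrite !inE => -[/= Cp pi] [/= Cq qj].
    move=> /(congr1 bin); rewrite /e !bin_value /= => E.
    have pq : p = q.
      by apply: (padding_disjoint (w := p ++ nseq i false) sd Cp Cq); [exists i|exists j].
    by rewrite pq in E *; rewrite (padding_inj E).
  - move=> n [/= n0]; rewrite domV => -[p Cp [j pj E]].
    by exists (p, j) => //; rewrite /e /= E value_bin.
rewrite -(@esum_esum _ _ _ _ _ (fun p j => (((e (p, j))%:R)^-1)%:E)); last first.
  by move=> p j _ _; rewrite lee_fin invr_ge0 ler0n.
apply: eq_esum => p Cp.
have -> : J p = [set` ones p] by apply/seteqP; split=> j /=; rewrite mem_ones.
rewrite esum_fset; [|exact: finite_seq|by move=> j _; rewrite lee_fin invr_ge0 ler0n].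
by rewrite -fsbig_seq ?filter_uniq ?iota_uniq // sumEFin sum_padding.
Qed.

End Sums.

Theorem theorem22 (R : realType) :
  exists T : TM, forall C : TM, self_delimiting C ->
    exists V : TM,
      computes T (encode C) (encode V) /\
      tuatara R V /\
      zeta R V = Omega R C /\
      dom C `<=` dom V /\
      exists S : word -> set word,
        (forall p : word, dom C p -> S p #= `I_(HW p).+1 /\ S p p) /\
        trivIset (dom C) S /\
        dom V = \bigcup_(p in dom C) S p.
Proof.
exists (compile translate [::]) => C sd; exists (tuatara_of C).
have domV := dom_tuatara_of C.
have zetaV := zeta_padding R sd domV.
split; first exact: computes_tuatara_of.
split; first by rewrite /tuatara zetaV; exact: Omega_le1.
split=> //; split.
  by move=> p Cp; rewrite domV; exists p => //; exact: padding_self.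
exists padding; split.
  by move=> p _; split; [exact: card_padding|exact: padding_self].
by split=> // p q Cp Cq [w [pw qw]]; apply: padding_disjoint sd Cp Cq pw qw.
Qed.
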